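(* Let $\psi(x,t)=\psi_h(x,t)$ for almost every $x\in\Omega$ and all $t\in\mathbb{R}$. Let $u_h^{cr}\in \mathcal{S}^{1,cr}_D(\mathcal{T}_h)$ and $z_h^{rt}\in \mathcal{R}T^0_N(\mathcal{T}_h)$ be such that $$I_h^{cr}(u_h^{cr})=D_h^{rt}(z_h^{rt}),$$ $$\int_{\Omega}\phi(\nabla_h u_h^{cr})\,dx=\sup_{y_h\in \mathcal{R}T^0_N(\mathcal{T}_h)}\Big\{\int_{\Omega}\nabla_h u_h^{cr}\cdot\Pi_h y_h\,dx-\int_{\Omega}\phi^*(\Pi_h y_h)\,dx\Big\},$$ $$\int_{\Omega}\psi_h^*(\cdot,\mathrm{div}(z_h^{rt}))\,dx=\sup_{v_h\in \mathcal{S}^{1,cr}_D(\mathcal{T}_h)}\Big\{\int_{\Omega}\mathrm{div}(z_h^{rt})\,\Pi_h v_h\,dx-\int_{\Omega}\psi_h(\cdot,\Pi_h v_h)\,dx\Big\}.$$ Then, for every $\tilde u_h\in\mathcal{S}^1_D(\mathcal{T}_h)$, $$\eta^2_{A,h}(\tilde u_h,z_h^{rt})=\int_\Omega \phi(\nabla\tilde u_h)-\Pi_h z_h^{rt}\cdot(\nabla\tilde u_h-\nabla_h u_h^{cr})-\phi(\nabla_h u_h^{cr})\,dx,$$ $$\eta^2_{B,h}(\tilde u_h,z_h^{rt})=\int_\Omega \psi_h(\cdot,\Pi_h\tilde u_h)-\mathrm{div}(z_h^{rt})\,(\Pi_h\tilde u_h-\Pi_h u_h^{cr})-\psi_h(\cdot,\Pi_h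 u_h^{cr})\,dx.$$
   Context: Domain and mesh: $\Omega\subseteq\mathbb{R}^d$, $d\in\mathbb{N}$, is a bounded polyhedral Lipschitz domain; $\partial\Omega=\Gamma_D\cup\Gamma_N$ is a disjoint union with $\Gamma_D$ closed. $\mathcal{T}_h$ is a shape-regular conforming triangulation of $\Omega$ into simplices with set of sides $\mathcal{S}_h$; each boundary side is contained in $\Gamma_D$ or in the closure of $\Gamma_N$. $x_S$ is the barycenter of a side $S$, $n_T$ the outward unit normal of $T$, $n$ the outward unit normal of $\Omega$, and $[\![\cdot]\!]_S$ the jump across an interior side $S$ (for vector fields $[\![y_h\cdot n]\!]_S=y_h|_{T_+}\cdot n_{T_+}+y_h|_{T_-}\cdot n_{T_-}$, with $T_\pm$ the two elements sharing $S$). Spaces and operators: $\mathcal{L}^k(\mathcal{T}_h)$ denotes functions that are polynomials of degree at most $k$ on each element. $\mathcal{S}^1_D(\mathcal{T}_h)$ is the space of continuous, element-wise affine functions vanishing on $\Gamma_D$. $\Pi_h$ is the $L^2$-projection onto element-wise constant functions (or vector fields). $\nabla_h$ is the element-wise gradient. $\mathcal{S}^{1,cr}_D(\mathcal{T}_h)$ (Crouzeix--Raviart space) is the set of $v_h\in\mathcal{L}^1(\mathcal{T}_h)$ with $\int_S[\![v_h]\!]_S\,ds=0$ for every interior side $S$ and $v_h(x_S)=0$ for every side $S\subseteq\Gamma_D$. $\mathcal{R}T^0_N(\mathcal{T}_h)$ (lowest order Raviart--Thomas space) is the set of $y_h\in\mathcal{L}^1(\mathcal{T}_h)^d$ such that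 $y_h|_T\cdot n_T$ is constant on each side of $T$ for all $T\in\mathcal{T}_h$, $[\![y_h\cdot n]\!]_S=0$ on every interior side $S$, and $y_h\cdot n=0$ on $\Gamma_N$. Functionals: $\phi:\mathbb{R}^d\to\mathbb{R}\cup\{+\infty\}$ is proper, convex and lower semi-continuous. $\psi:\Omega\times\mathbb{R}\to\mathbb{R}\cup\{+\infty\}$ is the measurable integrand of the continuous primal functional $I(v)=\int_\Omega\phi(\nabla v)\,dx+\int_\Omega\psi(\cdot,v)\,dx$, with $\psi(x,\cdot)$ proper, convex, lower semi-continuous for a.e. $x$. $\psi_h:\Omega\times\mathbb{R}\to\mathbb{R}\cup\{+\infty\}$ is such that $\psi_h(\cdot,t)$ is element-wise constant with respect to $\mathcal{T}_h$ for all $t\in\mathbb{R}$, and $\psi_h(x,\cdot)$ is proper, convex and lower semi-continuous for almost every $x\in\Omega$. $\phi^*$ and $\psi_h^*$ are the Fenchel conjugates ($\psi_h^*$ with respect to the second argument). Define $$I_h^{cr}(v_h)=\int_\Omega\phi(\nabla_h v_h)\,dx+\int_\Omega\psi_h(\cdot,\Pi_h v_h)\,dx,\qquad v_h\in\mathcal{S}^{1,cr}_D(\mathcal{T}_h),$$ $$D_h^{rt}(y_h)=-\int_\Omega\phi^*(\Pi_h y_h)\,dx-\int_\Omega\psi_h^*(\cdot,\mathrm{div}(y_h))\,dx,\qquad y_h\in\mathcal{R}T^0_N(\mathcal{T}_h).$$ It is a standing assumption that $\phi,\psi_h$ are such that $I_h^{cr}$ admits a minimizer. Estimator parts: for $\tilde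 u_h\in\mathcal{S}^1_D(\mathcal{T}_h)$, $\tilde z_h\in\mathcal{R}T^0_N(\mathcal{T}_h)$, $$\eta^2_{A,h}(\tilde u_h,\tilde z_h)=\int_\Omega\phi(\nabla\tilde u_h)-\Pi_h\tilde z_h\cdot\nabla\tilde u_h+\phi^*(\Pi_h\tilde z_h)\,dx,$$ $$\eta^2_{B,h}(\tilde u_h,\tilde z_h)=\int_\Omega\psi_h(\cdot,\Pi_h\tilde u_h)-\mathrm{div}(\tilde z_h)\,\Pi_h\tilde u_h+\psi_h^*(\cdot,\mathrm{div}(\tilde z_h))\,dx .$$ *)

(* Defs.v *)
From HB Require Import structures.
From mathcomp Require Import all_boot all_order all_algebra.
From mathcomp Require Import all_classical all_reals all_analysis.
From mathcomp Require Import measurable_realfun.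

Set Implicit Arguments.
Unset Strict Implicit.
Unset Printing Implicit Defensive.
Import Order.TTheory GRing.Theory Num.Theory.
Import numFieldNormedType.Exports.
Local Open Scope classical_set_scope.
Local Open Scope ring_scope.

Section measurable_rV.
Context {R : realType} (n : nat).

Definition rV_coord (j : 'I_n) (x : 'rV[R]_n) : measurableTypeR R := x 0 j.

Let rV_set0 : g_sigma_preimage rV_coord set0.
Proof. exact: sigma_algebra0. Qed.

Let rV_setC A : g_sigma_preimage rV_coord A -> g_sigma_preimage rV_coord (~` A).
Proof. exact: sigma_algebraC. Qed.

Let rV_bigcup (F : _^nat) : (forall i, g_sigma_preimage rV_coord (F i)) ->
  g_sigma_preimage rV_coord (\bigcup_i (F i)).
Proof. exact: sigma_algebra_bigcup. Qed.

HB.instance Definition _ :=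
  @isMeasurable.Build (measure_tuple_display default_measure_display)
    'rV[R]_n (g_sigma_preimage rV_coord) rV_set0 rV_setC rV_bigcup.

Lemma measurable_rV_coord (j : 'I_n) : measurable_fun [set: 'rV[R]_n] (rV_coord j).
Proof.
move=> _ Y mY; rewrite setTI; apply: sub_sigma_algebra => /=.
rewrite -bigcup_seq/=; exists j => /=; first by rewrite mem_index_enum.
by exists Y => //; rewrite setTI.
Qed.

Lemma measurable_fun_rVP d (T : measurableType d) (f : T -> 'rV[R]_n) :
  (forall j, measurable_fun [set: T] (rV_coord j \o f)) ->
  measurable_fun [set: T] f.
Proof.
move=> mf _ A mA; rewrite setTI; move: A mA.
change (<<s \big[setU/set0]_(i < n)
  preimage_set_system setT (@rV_coord i) measurable >>
  `<=` [set A | measurable (f @^-1` A)]).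
apply: smallest_sub; last first.
  rewrite -bigcup_seq/=; apply: bigcup_sub => j _ _ [B mB <-] /=.
  by rewrite setTI -comp_preimage -[X in measurable X]setTI; exact: mf.
split => /=.
- by rewrite preimage_set0.
- by move=> B mB; rewrite setTD preimage_setC; exact: measurableC.
- by move=> F mF; rewrite preimage_bigcup; exact: bigcup_measurable.
Qed.

End measurable_rV.

Section lebesgue_rV.
Context {R : realType}.

Definition rV_cons n (p : measurableTypeR R * 'rV[R]_n) : 'rV[R]_n.+1 :=
  \row_i (if unlift ord0 i is Some j then p.2 0 j else p.1).

Definition rV_uncons n (x : 'rV[R]_n.+1) : measurableTypeR R * 'rV[R]_n :=
  (x 0 ord0, \row_j x 0 (lift ord0 j)).

Lemma rV_consK n : cancel (@rV_cons n) (@rV_uncons n).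
Proof.
move=> [t y]; rewrite /rV_uncons /rV_cons/=; congr pair.
  by rewrite mxE unlift_none.
by apply/rowP => j; rewrite !mxE liftK.
Qed.

Lemma rV_unconsK n : cancel (@rV_uncons n) (@rV_cons n).
Proof.
move=> x; apply/rowP => i; rewrite mxE /rV_uncons/=.
by have [j ->|->] := unliftP ord0 i; rewrite ?mxE.
Qed.

Lemma measurable_rV_cons n : measurable_fun [set: _] (@rV_cons n).
Proof.
apply: measurable_fun_rVP => i; have [j ->|->] := unliftP ord0 i.
  rewrite (_ : _ \o _ = rV_coord j \o snd).
    apply: measurableT_comp; [exact: measurable_rV_coord|exact: measurable_snd].
  apply/funext => p /=; rewrite /rV_coord -[in RHS](rV_consK p).
  by rewrite /rV_uncons/= mxE.
rewrite (_ : _ \o _ = fst); first exact: measurable_fst.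
by apply/funext => p /=; rewrite /rV_coord -[in RHS](rV_consK p).
Qed.

Lemma measurable_rV_uncons n : measurable_fun [set: _] (@rV_uncons n).
Proof.
apply/measurable_fun_pairP; split; first exact: (measurable_rV_coord ord0).
apply: measurable_fun_rVP => j.
rewrite (_ : _ \o _ = rV_coord (lift ord0 j)); first exact: measurable_rV_coord.
by apply/funext => x /=; rewrite /rV_coord mxE.
Qed.

Section step.
Context n (m : {sigma_finite_measure set 'rV[R]_n -> \bar R}).

Definition lebesgue_step : set 'rV[R]_n.+1 -> \bar R :=
  pushforward (lebesgue_measure \x m)%E (@rV_cons n).

Let preimage_measurable (A : set 'rV[R]_n.+1) :
  measurable A -> measurable (@rV_cons n @^-1` A).
Proof. by move=> mA; rewrite -[X in measurable X]setTI; exact: measurable_rV_cons. Qed.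

Let step0 : lebesgue_step set0 = 0%E.
Proof. by rewrite /lebesgue_step /pushforward preimage_set0 measure0. Qed.

Let step_ge0 A : (0 <= lebesgue_step A)%E.
Proof. exact: (measure_ge0 (lebesgue_measure \x m)%E). Qed.

Let step_sigma_additive : semi_sigma_additive lebesgue_step.
Proof.
move=> F mF tF mUF; rewrite /lebesgue_step /pushforward preimage_bigcup.
apply: measure_semi_sigma_additive.
- by move=> i; exact: preimage_measurable.
- apply/trivIsetP => /= i j _ _ ij; rewrite -preimage_setI.
  by move/trivIsetP : tF => /(_ _ _ _ _ ij) ->//; rewrite preimage_set0.
- by rewrite -preimage_bigcup; exact: preimage_measurable.
Qed.

HB.instance Definition _ := isMeasure.Build _ _ _ lebesgue_step
  step0 step_ge0 step_sigma_additive.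

Let step_sigma_finite : sigma_finite setT lebesgue_step.
Proof.
have /sigma_finiteP[F [TF ndF Foo]] := sigma_finiteT (@lebesgue_measure R).
have /sigma_finiteP[G [TG ndG Goo]] := sigma_finiteT m.
exists (fun k => @rV_uncons n @^-1` (F k `*` G k)).
  rewrite -preimage_bigcup; apply/esym; rewrite -subTset => x _.
  have [i _ Fi] : (\bigcup_i F i) (rV_uncons x).1 by rewrite -TF.
  have [j _ Gj] : (\bigcup_i G i) (rV_uncons x).2 by rewrite -TG.
  exists (maxn i j) => //; split.
  - by move: Fi; exact/subsetPset/ndF/leq_maxl.
  - by move: Gj; exact/subsetPset/ndG/leq_maxr.
move=> k; have [mF Fk] := Foo k; have [mG Gk] := Goo k; split.
  rewrite -[X in measurable X]setTI; apply: measurable_rV_uncons => //.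
  exact: measurableX.
rewrite /lebesgue_step /pushforward -comp_preimage.
rewrite (_ : _ \o _ = id) ?preimage_id; last exact/funext/rV_consK.
by rewrite product_measure1E// lte_mul_pinfty// ge0_fin_numE.
Qed.

HB.instance Definition _ := Measure_isSigmaFinite.Build _ _ _ lebesgue_step
  step_sigma_finite.

End step.

(** Product of [n] copies of the Lebesgue measure on the real line, carried by
    row vectors; for [n = 0] it is the unit mass at the only point. *)
Fixpoint lebesgue_rV n : {sigma_finite_measure set 'rV[R]_n -> \bar R} :=
  match n with
  | 0 => (\d_(0 : 'rV[R]_0))
  | n'.+1 => lebesgue_step (lebesgue_rV n')
  end.

Lemma lebesgue_rV_box n (A : 'I_n -> set R) :
  (forall j, measurable (A j : set (measurableTypeR R))) ->
  lebesgue_rV n [set x | forall j, A j (x 0 j)] =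
  (\prod_(j < n) lebesgue_measure (A j))%E.
Proof.
elim: n A => [|n IH] A mA.
  by rewrite big_ord0 /= diracE mem_set// => -[].
rewrite big_ord_recl -IH//=.
have mB : measurable [set y : 'rV[R]_n | forall j, A (lift ord0 j) (y 0 j)].
  rewrite (_ : mkset _ =
      \bigcap_(j in [set: 'I_n]) (rV_coord j @^-1` A (lift ord0 j))).
    apply: fin_bigcap_measurable => // j _.
    by rewrite -[X in measurable X]setTI; exact: measurable_rV_coord.
  by apply/seteqP; split=> [y yA j _|y yA j]; exact: yA.
rewrite -product_measure1E//; congr product_measure1.
apply/seteqP; split=> [p pA|p [pA0 pA] i] /=.
  split=> [|j] /=; first by have := pA ord0; rewrite mxE unlift_none.
  by have := pA (lift ord0 j); rewrite mxE liftK.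
by rewrite mxE; have [j ->|->//] := unliftP ord0 i; exact: pA.
Qed.

End lebesgue_rV.

Section vectors.
Context {R : realType} {n : nat}.
Implicit Types x y : 'rV[R]_n.

Definition dotv x y : R := \sum_(j < n) x 0 j * y 0 j.

(* The library norm on row vectors is the maximum norm. *)
Definition enorm x : R := Num.sqrt (dotv x x).

End vectors.

Section differential_operators.
Context {R : realType} {n : nat}.

Definition gradient (f : 'rV[R]_n.+1 -> R) (x : 'rV[R]_n.+1) : 'rV[R]_n.+1 :=
  \row_j 'D_(delta_mx 0 j) f x.

Definition divergence (y : 'rV[R]_n.+1 -> 'rV[R]_n.+1) (x : 'rV[R]_n.+1) : R :=
  \sum_(j < n.+1) 'D_(delta_mx 0 j) (fun z => y z 0 j) x.

End differential_operators.

Section convex_functions.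
Context {R : realType}.
Local Open Scope ereal_scope.

Definition proper_fun (T : Type) (f : T -> \bar R) : Prop :=
  (forall t, f t != -oo) /\ (exists t, f t < +oo).

Definition convex_efun (V : lmodType R) (f : V -> \bar R) : Prop :=
  forall (a : R) (s t : V), (0 < a < 1)%R ->
    f (a *: s + (1 - a) *: t)%R <= a%:E * f s + (1 - a)%:E * f t.

Definition conjugate (T : Type) (pairing : T -> T -> R) (f : T -> \bar R)
    (s : T) : \bar R :=
  ereal_sup [set (pairing s t)%:E - f t | t in [set: T]].

Definition pcl_rV n (f : 'rV[R]_n.+1 -> \bar R) : Prop :=
  [/\ proper_fun f, convex_efun f & lower_semicontinuous f].

Definition pcl_R (f : R -> \bar R) : Prop :=
  [/\ proper_fun f, convex_efun (f : R^o -> \bar R) & lower_semicontinuous f].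

Definition conj_rV n (f : 'rV[R]_n.+1 -> \bar R) : 'rV[R]_n.+1 -> \bar R :=
  conjugate dotv f.

Definition conj_R (f : R -> \bar R) : R -> \bar R := conjugate *%R f.

End convex_functions.

Section simplices.
Context {R : realType} {n : nat}.
Implicit Types (A : set 'rV[R]_n) (x : 'rV[R]_n).

Definition convex_hull A : set 'rV[R]_n :=
  [set x | exists (k : nat) (s : 'I_k -> 'rV[R]_n) (l : 'I_k -> R),
    [/\ forall i, A (s i), forall i, 0 <= l i, \sum_(i < k) l i = 1
      & x = \sum_(i < k) l i *: s i]].

Definition affinely_independent k (s : 'I_k -> 'rV[R]_n) : Prop :=
  forall l : 'I_k -> R, \sum_(i < k) l i = 0 -> \sum_(i < k) l i *: s i = 0 ->
    forall i, l i = 0.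

Definition barycenter k (s : 'I_k -> 'rV[R]_n) : 'rV[R]_n :=
  k%:R^-1 *: \sum_(i < k) s i.

Definition ref_simplex {k} : set 'rV[R]_k :=
  [set t | (forall j, 0 <= t 0 j) /\ \sum_(j < k) t 0 j <= 1].

Definition edge_mx k (s : 'I_k.+1 -> 'rV[R]_n) : 'M[R]_(k, n) :=
  \matrix_(j < k) (s (lift ord0 j) - s ord0).

(* Integral over the k-dimensional simplex with vertices s for the surface
   measure, in the affine parametrization of the simplex over the reference
   simplex: the constant is the square root of the Gram determinant. *)
Definition simplex_integral k (s : 'I_k.+1 -> 'rV[R]_n) (f : 'rV[R]_n -> R) : R :=
  Num.sqrt (\det (edge_mx s *m (edge_mx s)^T)) *
  \int[lebesgue_rV k]_(t in ref_simplex) f (s ord0 + t *m edge_mx s).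

End simplices.

Section domains.
Context {R : realType} {n : nat}.
Local Notation E := 'rV[R]_n.+1.
Implicit Types Om : set E.

Definition bd Om : set E := closure Om `\` Om°.

(* Near each boundary point, Om is the strict epigraph, in some unit direction
   e, of a Lipschitz function of the coordinates orthogonal to e. *)
Definition lipschitz_boundary Om : Prop :=
  forall x, bd Om x -> exists (e : E) (g : E -> R) (L r : R),
    [/\ enorm e = 1, 0 < r, forall y z, `|g y - g z| <= L * enorm (y - z)
      & forall y, enorm (y - x) < r ->
          (Om y <-> g (y - dotv y e *: e) < dotv y e)].

Definition polyhedral Om : Prop :=
  exists s : seq (E * R), (forall p, p \in s -> p.1 != 0) /\
    bd Om `<=` [set x | exists2 p, p \in s & dotv p.1 x = p.2].

Definition polyhedral_lipschitz_domain Om : Prop :=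
  [/\ open Om, connected Om, Om !=set0 & bounded_set Om] /\
  polyhedral Om /\ lipschitz_boundary Om.

Definition boundary_partition Om (GD GN : set E) : Prop :=
  [/\ GD `|` GN = bd Om, GD `&` GN = set0 & closed GD].

End domains.

(* A finite family of simplices in dimension n.+1. *)
Record mesh (R : realType) (n : nat) := Mesh {
  elt : finType;
  vtx : elt -> 'I_n.+2 -> 'rV[R]_n.+1 }.
Arguments vtx {R n} m T i.

Section meshes.
Context {R : realType} {n : nat} (M : mesh R n).
Local Notation E := 'rV[R]_n.+1.
Implicit Types (T : elt M) (i : 'I_n.+2) (Om : set E).

Definition vertices T : set E := range (vtx M T).

Definition cell T : set E := convex_hull (vertices T).

(* The side of T opposite to its i-th vertex; side_vtx enumerates its vertices. *)
Definition side_vtx T i : 'I_n.+1 -> E := fun j => vtx M T (lift i j).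

Definition side T i : set E := convex_hull (range (side_vtx T i)).

Definition triangulation Om : Prop :=
  [/\ forall T, affinely_independent (vtx M T),
      forall T T', cell T = cell T' -> T = T',
      forall T T', cell T `&` cell T' = convex_hull (vertices T `&` vertices T')
    & closure Om = \bigcup_(T in [set: elt M]) cell T].

(* Every element T contains a ball of radius rho with diam T <= kappa * rho. *)
Definition shape_regular (kappa : R) : Prop :=
  forall T, exists (x : E) (rho : R),
    [/\ 0 < rho, forall y, enorm (y - x) <= rho -> cell T y
      & forall y z, cell T y -> cell T z -> enorm (y - z) <= kappa * rho].

Definition sides_resolve Om (GD GN : set E) : Prop :=
  forall T i, side T i `<=` bd Om ->
    side T i `<=` GD \/ side T i `<=` closure GN.

(* The side opposite to vertex i of T and the one opposite to vertex i' of T'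
   are one and the same interior side, shared by T and T'. *)
Definition interior_side T i T' i' : Prop := T <> T' /\ side T i = side T' i'.

Definition is_outward_normal T i (nu : E) : Prop :=
  [/\ enorm nu = 1,
      forall x y, side T i x -> side T i y -> dotv nu (x - y) = 0
    & forall x, side T i x -> dotv nu (vtx M T i - x) < 0].

Definition normal T i : E := xget 0 [set nu | is_outward_normal T i nu].

(* An element-wise function is a family indexed by the elements; [glue f] is
   the associated function on the union of the elements. Points shared by
   several elements form a null set, on which one of the values is selected. *)
Definition glue (V : nmodType) (f : elt M -> E -> V) (x : E) : V :=
  if [pick T | `[< cell T x >]] is Some T then f T x else 0.

Definition gluec (V : nmodType) (c : elt M -> V) : E -> V :=
  glue (fun T _ => c T).

Definition affine_fun (p : E -> R) : Prop :=
  exists (a : R) (g : E), forall x, p x = a + dotv g x.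

(* In L1 and L1v, v T is the polynomial representing the restriction to T, so
   that it also provides the trace on the sides of T. *)
Definition L1 (v : elt M -> E -> R) : Prop := forall T, affine_fun (v T).

Definition L1v (y : elt M -> E -> E) : Prop :=
  forall T j, affine_fun (fun x => y T x 0 j).

Definition grad_h (v : elt M -> E -> R) : E -> E :=
  glue (fun T => gradient (v T)).

Definition div_h (y : elt M -> E -> E) : E -> R :=
  glue (fun T => divergence (y T)).

Definition is_L2_projection Om (v : elt M -> E -> R) (p : {ffun elt M -> R}) :=
  forall q : {ffun elt M -> R},
    \int[lebesgue_rV n.+1]_(x in Om)
      ((glue v x - gluec p x) * gluec q x) = 0.

Definition is_L2_projectionv Om (y : elt M -> E -> E) (p : {ffun elt M -> E}) :=
  forall q : {ffun elt M -> E},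
    \int[lebesgue_rV n.+1]_(x in Om)
      dotv (glue y x - gluec p x) (gluec q x) = 0.

Definition Pi_h Om (v : elt M -> E -> R) : E -> R :=
  gluec (xget 0 [set p | is_L2_projection Om v p]).

Definition Pi_hv Om (y : elt M -> E -> E) : E -> E :=
  gluec (xget 0 [set p | is_L2_projectionv Om y p]).

(* Values on the interfaces between elements are irrelevant. *)
Definition elementwise_constant (A : Type) (f : E -> A) : Prop :=
  forall T, exists c, forall x, (cell T)° x -> f x = c.

Definition S1D Om (GD : set E) (v : elt M -> E -> R) : Prop :=
  L1 v /\ exists u : E -> R,
    [/\ {within closure Om, continuous u},
        forall T x, cell T x -> v T x = u x & forall x, GD x -> u x = 0].

Definition CR (GD : set E) (v : elt M -> E -> R) : Prop :=
  [/\ L1 v,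
      forall T i T' i', interior_side T i T' i' ->
        simplex_integral (side_vtx T i) (fun x => v T x - v T' x) = 0
    & forall T i, side T i `<=` GD -> v T (barycenter (side_vtx T i)) = 0].

(* On a side contained in the boundary, the outward normals of Om and of the
   adjacent element agree. *)
Definition RT Om (GN : set E) (y : elt M -> E -> E) : Prop :=
  [/\ L1v y,
      forall T i, exists c, forall x, side T i x -> dotv (y T x) (normal T i) = c,
      forall T i T' i', interior_side T i T' i' -> forall x, side T i x ->
        dotv (y T x) (normal T i) + dotv (y T' x) (normal T' i') = 0
    & forall T i, side T i `<=` bd Om -> forall x, side T i x -> GN x ->
        dotv (y T x) (normal T i) = 0].

End meshes.
Arguments S1D {R n} M Om GD v.
Arguments CR {R n} M GD v.
Arguments RT {R n} M Om GN y.

Section functionals.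
Context {R : realType} {n : nat} (M : mesh R n).
Local Notation E := 'rV[R]_n.+1.
Local Open Scope ereal_scope.
Variables (Om : set E) (phi : E -> \bar R) (psih : E -> R -> \bar R).
Implicit Types (v u : elt M -> E -> R) (y z : elt M -> E -> E).
Local Notation leb := (lebesgue_rV n.+1).

Definition I_cr v : \bar R :=
  \int[leb]_(x in Om) phi (grad_h v x) +
  \int[leb]_(x in Om) psih x (Pi_h Om v x).

Definition D_rt y : \bar R :=
  - (\int[leb]_(x in Om) conj_rV phi (Pi_hv Om y x)) -
  \int[leb]_(x in Om) conj_R (psih x) (div_h y x).

Definition etaA2 u z : \bar R :=
  \int[leb]_(x in Om)
    (phi (grad_h u x) - (dotv (Pi_hv Om z x) (grad_h u x))%:E
     + conj_rV phi (Pi_hv Om z x)).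

Definition etaB2 u z : \bar R :=
  \int[leb]_(x in Om)
    (psih x (Pi_h Om u x) - (div_h z x * Pi_h Om u x)%:E
     + conj_R (psih x) (div_h z x)).

End functionals.
Arguments I_cr {R n} M Om phi psih v.
Arguments D_rt {R n} M Om phi psih y.
Arguments etaA2 {R n} M Om phi u z.
Arguments etaB2 {R n} M Om psih u z.

(* Measurability of an integrand on Om x R for the product of the Lebesgue
   sigma-algebra of Om and the Borel sigma-algebra of R. *)
Definition measurable_integrand (R : realType) n (Om : set 'rV[R]_n.+1)
    (psi : 'rV[R]_n.+1 -> R -> \bar R) : Prop :=
  exists N : set 'rV[R]_n.+1,
    [/\ measurable N, lebesgue_rV n.+1 N = 0%E
      & measurable_fun ((Om `\` N) `*` [set: measurableTypeR R])
          ((fun p => psi p.1 p.2) :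
             'rV[R]_n.+1 * measurableTypeR R -> \bar R)].

(* Main.v *)
Require Import Defs.
From mathcomp Require Import all_boot all_order all_algebra.
From mathcomp Require Import all_classical all_reals all_analysis.
From mathcomp Require Import measurable_realfun ring lra.
Set Implicit Arguments.
Unset Strict Implicit.
Unset Printing Implicit Defensive.
Import Order.TTheory GRing.Theory Num.Theory.
Import numFieldNormedType.Exports.
Local Open Scope classical_set_scope.
Local Open Scope ring_scope.

(** The key point is the discrete integration by parts formula
    \int grad_h u . Pi_h z + \int div z Pi_h u = 0 for Crouzeix-Raviart u and
    Raviart-Thomas z. As Pi_h of an affine function is its value at the
    barycenter, the formula reduces on each simplex to an algebraic identity
    between barycentric coordinates whose right-hand side is the sum over the
    sides S of |S| (z . n_T) u(x_S). These contributions cancel on interior sides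
    and vanish on boundary sides.
    Adding the Fenchel-Young inequalities for phi and psi_h element by element,
    I_h(u) - D_h(z) is a positive combination of non-negative gaps, so
    I_h(u) = D_h(z) forces every gap to vanish; substituting the resulting values
    of phi^* and psi_h^* gives both formulas. *)

(** * Affine changes of variables *)

(** [lebesgue_rV] is an iterated product measure, so every volume argument rests on its behaviour
    under affine maps, obtained by slicing. On simplices the maps used are x + l(x) w with l affine.
    Exchanging two vertices gives all barycentric coordinates the same mean, whence the barycenter
    rule. Moving one vertex while the opposite face stays fixed shows that the volume times the
    length of the gradient of the corresponding coordinate depends on the face alone; this quantity
    stands for |S|/(n+1), and the Gram determinant of [simplex_integral] enters only through its
    positivity. Sides are grouped by equality as sets, a form of cancellation that works for any
    number of neighbours. The second obstacle is extended values: [phi] and [psih] may be +oo, and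
    [psih] is controlled only almost everywhere. Outside a null set of hyperplanes the integrals of
    the primal and dual functionals become finite weighted sums over elements. Since no summand is
    -oo, the equality of the two functionals forces all of them to be finite, and only then are gaps
    subtracted. *)

Section lebesgue_affine.
Context {R : realType}.
Local Notation leb := (@lebesgue_measure R).

Lemma measurable_affine (a b : R) : measurable_fun [set: measurableTypeR R]
    ((fun t => a * t + b) : measurableTypeR R -> measurableTypeR R).
Proof.
apply: measurable_funD; last exact: measurable_cst.
by apply: measurable_funM; [exact: measurable_cst|exact: measurable_id].
Qed.

(** Uniqueness of Lebesgue measure: the left side is a measure in [B] with the right value on
    half-open intervals. *)
Lemma lebesgue_measure_pos_affine (a b : R) (B : set (measurableTypeR R)) :
  0 < a -> measurable B ->
  (a%:E * leb ((fun t => a * t + b)%R @^-1` B) = leb B)%E.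
Proof.
move=> a0 mB.
have /(_ _ B mB) -> // := @lebesgue_measure_unique R (mscale (NngNum (ltW a0))
  (measure_function_pushforward__canonical__measure_function_Measure
     leb (measurable_affine a b))).
move=> _ [[x y]] _ <-.
pose J := `](x - b) / a, (y - b) / a]%classic.
have E : (fun t => a * t + b) @^-1` `]x, y] = J.
  apply/seteqP; rewrite /J; split=> t /=; rewrite !in_itv/= ltr_pdivrMr// ler_pdivlMr//;
    move=> /andP[? ?]; apply/andP; split; lra.
transitivity (a%:E * leb J)%E; last by rewrite -E.
rewrite /J !lebesgue_measure_itv/= !lte_fin ltr_pM2r ?invr_gt0// ltrD2r.
case: ifPn => _; last by rewrite mule0.
by rewrite -!EFinD -EFinM; congr EFin; field; lra.
Qed.

Lemma lebesgue_measure_affine (a b : R) (B : set (measurableTypeR R)) :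
  a != 0 -> measurable B ->
  (`|a|%:E * leb ((fun t => a * t + b)%R @^-1` B) = leb B)%E.
Proof.
move=> a0 mB; have [ap|an|/eqP] := ltgtP 0 a; last by rewrite eq_sym (negbTE a0).
  by rewrite ger0_norm ?ltW//; exact: lebesgue_measure_pos_affine.
rewrite ltr0_norm//.
have mB' : measurable ((fun t : R => - a * t + b) @^-1` B : set (measurableTypeR R)).
  by rewrite -[X in measurable X]setTI; exact: measurable_affine.
rewrite -[RHS](@lebesgue_measure_pos_affine (- a) b)//; last lra.
congr (_ * _)%E; rewrite -[RHS]lebesgue_measureN// /pushforward.
by congr leb; apply/funext => t /=; rewrite mulrNN.
Qed.

End lebesgue_affine.

Section slices.
Context {R : realType} (n : nat).
Local Notation leb := (@lebesgue_measure R).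
Local Notation mu := (@lebesgue_rV R).

Lemma measurable_rV_cons_preimage (B : set 'rV[R]_n.+1) : measurable B ->
  measurable (@rV_cons R n @^-1` B).
Proof. by move=> mB; rewrite -[X in measurable X]setTI; exact: measurable_rV_cons. Qed.

Lemma lebesgue_rVS1 (B : set 'rV[R]_n.+1) :
  mu n.+1 B = (\int[leb]_t mu n (xsection (@rV_cons R n @^-1` B) t))%E.
Proof. by []. Qed.

(** Tonelli: the definition integrates over the first coordinate last, and uniqueness of the product
    measure allows the other order. *)
Lemma lebesgue_rVS2 (B : set 'rV[R]_n.+1) : measurable B ->
  mu n.+1 B = (\int[mu n]_y leb (ysection (@rV_cons R n @^-1` B) y))%E.
Proof.
move=> mB; apply: (@product_measure_unique _ _ _ _ _ leb (mu n)
   (leb \x^ mu n)%E); last exact: measurable_rV_cons_preimage.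
by move=> *; rewrite /= product_measure2E.
Qed.

(** Cavalieri's principle. This version serves maps that preserve the first coordinate, the next one
    maps that preserve all the others. *)
Lemma lebesgue_rV_slice1 (c : R) (A B : set 'rV[R]_n.+1) : 0 <= c ->
  measurable A -> measurable B ->
  (forall t, c%:E * mu n [set y | A (rV_cons (t, y))]
             = mu n [set y | B (rV_cons (t, y))])%E ->
  (c%:E * mu n.+1 A = mu n.+1 B)%E.
Proof.
move=> c0 mA mB AB; rewrite !lebesgue_rVS1 -ge0_integralZl//.
- apply: eq_integral => t _; move: (AB t).
  by congr (_ * mu n _ = mu n _)%E; apply/seteqP; split => y; rewrite /xsection/= inE.
- by apply: measurable_fun_xsection; exact: measurable_rV_cons_preimage.
Qed.

Lemma lebesgue_rV_slice2 (c : R) (A B : set 'rV[R]_n.+1) : 0 <= c ->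
  measurable A -> measurable B ->
  (forall y, c%:E * leb [set t | A (rV_cons (t, y))]
             = leb [set t | B (rV_cons (t, y))])%E ->
  (c%:E * mu n.+1 A = mu n.+1 B)%E.
Proof.
move=> c0 mA mB AB; rewrite !lebesgue_rVS2// -ge0_integralZl//.
- apply: eq_integral => t _; move: (AB t).
  by congr (_ * leb _ = leb _)%E; apply/seteqP; split => y; rewrite /ysection/= inE.
- by apply: measurable_fun_ysection; exact: measurable_rV_cons_preimage.
Qed.

End slices.

Section affine_change_of_variables.
Context {R : realType}.
Local Notation mu := (@lebesgue_rV R).
Local Notation leb := (@lebesgue_measure R).

Lemma measurable_affine_rV n (A : 'M[R]_n) (c : 'rV[R]_n) :
  measurable_fun [set: 'rV[R]_n] (fun x => x *m A + c).
Proof.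
apply: measurable_fun_rVP => j.
rewrite (_ : _ \o _ = (fun x : 'rV[R]_n =>
    (\sum_k rV_coord k x * A k j + c 0 j : measurableTypeR R))); last first.
  by apply/funext => x; rewrite /rV_coord/= !mxE.
apply: measurable_funD; last exact: measurable_cst.
apply: measurable_sum => k; apply: measurable_funM; last exact: measurable_cst.
exact: measurable_rV_coord.
Qed.

Lemma measurable_affine_preimage n (A : 'M[R]_n) (c : 'rV[R]_n)
    (B : set 'rV[R]_n) :
  measurable B -> measurable [set x | B (x *m A + c)].
Proof.
by move=> mB; rewrite -[X in measurable X]setTI; exact: measurable_affine_rV.
Qed.

Lemma measurable_linear_preimage n (A : 'M[R]_n) (B : set 'rV[R]_n) :
  measurable B -> measurable [set x | B (x *m A)].
Proof.
move=> mB; have := measurable_affine_preimage A 0 mB.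
by congr measurable; apply/funext => x /=; rewrite addr0.
Qed.

Lemma measurable_translation_preimage n (c : 'rV[R]_n) (B : set 'rV[R]_n) :
  measurable B -> measurable [set x | B (x + c)].
Proof.
move=> mB; have := measurable_affine_preimage 1%:M c mB.
by congr measurable; apply/funext => x /=; rewrite mulmx1.
Qed.

Lemma rV_consE n (t : R) (y : 'rV[R]_n) :
  rV_cons (t, y) = row_mx t%:M y :> 'rV[R]_(1 + n).
Proof.
apply/rowP => i; rewrite !mxE.
have [j ->|->] := unliftP ord0 i; case: splitP => k.
- by rewrite (ord1 k).
- by rewrite /= /bump/= !add1n => -[] /val_inj ->.
- by move=> _; rewrite (ord1 k) mxE.
- by [].
Qed.

Lemma rV_consD n (t s : R) (y z : 'rV[R]_n) :
  rV_cons (t, y) + rV_cons (s, z) = rV_cons (t + s, y + z).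
Proof. by apply/rowP => i; rewrite !mxE/=; case: unlift => [j|]; rewrite ?mxE. Qed.

Lemma measurable_slice1 n (B : set 'rV[R]_n.+1) t : measurable B ->
  measurable [set y | B (rV_cons (t, y))].
Proof.
move=> mB; have := measurable_xsection t (measurable_rV_cons_preimage mB).
by congr measurable; apply/seteqP; split => y; rewrite /xsection/= inE.
Qed.

Lemma measurable_slice2 n (B : set 'rV[R]_n.+1) y : measurable B ->
  measurable ([set t | B (rV_cons (t, y))] : set (measurableTypeR R)).
Proof.
move=> mB; have := measurable_ysection y (measurable_rV_cons_preimage mB).
by congr measurable; apply/seteqP; split => t; rewrite /ysection/= inE.
Qed.

Lemma lebesgue_rV_translation n (c : 'rV[R]_n) (B : set 'rV[R]_n) :
  measurable B -> mu n [set x | B (x + c)] = mu n B.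
Proof.
elim: n c B => [|n IH] c B mB.
  by congr (mu 0 _); apply/funext => x /=; congr B; rewrite [RHS]thinmx0 [LHS]thinmx0.
have [s [z ->]] : exists s z, c = rV_cons (s, z).
  by exists (rV_uncons c).1, (rV_uncons c).2; rewrite -surjective_pairing rV_unconsK.
have mB' := @measurable_translation_preimage _ (rV_cons (0, z)) B mB.
rewrite -[LHS]mul1e.
transitivity (mu n.+1 [set x | B (x + rV_cons (0, z))]).
  apply: lebesgue_rV_slice2 => //; first exact: measurable_translation_preimage.
  move=> y; rewrite mul1e.
  have mC : measurable ([set t | B (rV_cons (t, y + z))] : set (measurableTypeR R)).
    exact: measurable_slice2.
  have := @lebesgue_measure_affine R 1 s _ (oner_neq0 _) mC.
  rewrite normr1 mul1e => E.
  transitivity (leb [set t | B (rV_cons (t, y + z))]).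
    rewrite -E; congr leb; apply/funext => t /=.
    by rewrite rV_consD mul1r.
  by congr leb; apply/funext => t /=; rewrite rV_consD addr0.
rewrite -[LHS]mul1e; apply: lebesgue_rV_slice1 => // t; rewrite mul1e.
have mC : measurable [set y | B (rV_cons (t, y))].
  exact: measurable_slice1.
rewrite -[RHS](IH z)//; congr (mu n _); apply/funext => y /=.
by rewrite rV_consD addr0.
Qed.

(** Preimages instead of images keep measurability automatic. The property is stable under products,
    so elementary factors can be treated one by one. *)
Definition scales_lebesgue n (A : 'M[R]_n) : Prop :=
  forall B : set 'rV[R]_n, measurable B ->
    (`|\det A|%:E * mu n [set x | B (x *m A)] = mu n B)%E.

Lemma scales_lebesgueM n (A A' : 'M[R]_n) :
  scales_lebesgue A -> scales_lebesgue A' -> scales_lebesgue (A *m A').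
Proof.
move=> sA sA' B mB; rewrite det_mulmx normrM mulrC EFinM -muleA.
rewrite -[RHS]sA'//; congr (_ * _)%E.
rewrite -[RHS]sA; last exact: measurable_linear_preimage.
by congr (_ * mu n _)%E; apply/funext => x /=; rewrite mulmxA.
Qed.

Lemma scales_lebesgue_dr n (A : 'M[R]_n) : scales_lebesgue A ->
  scales_lebesgue (block_mx 1%:M 0 0 A : 'M[R]_(1 + n)).
Proof.
move=> sA B mB; rewrite det_ublock det1 mul1r.
apply: lebesgue_rV_slice1 => //; first exact: measurable_linear_preimage.
move=> t; rewrite -[RHS]sA; last exact: measurable_slice1.
congr (_ * mu n _)%E; apply/funext => y /=; congr B.
by rewrite !rV_consE mul_row_block mulmx1 !mulmx0 addr0 add0r.
Qed.

Lemma scales_lebesgue_ul n (a : R) : a != 0 ->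
  scales_lebesgue (block_mx a%:M 0 0 1%:M : 'M[R]_(1 + n)).
Proof.
move=> a0 B mB; rewrite det_ublock det1 mulr1 det_scalar1.
apply: lebesgue_rV_slice2 => //; first exact: measurable_linear_preimage.
move=> y; rewrite -[RHS](lebesgue_measure_affine 0 a0); last exact: measurable_slice2.
congr (_ * leb _)%E; apply/funext => t /=; congr B.
by rewrite !rV_consE mul_row_block mulmx1 !mulmx0 addr0 add0r -scalar_mxM mulrC addr0.
Qed.

Lemma scales_lebesgue_ur n (w : 'rV[R]_n) :
  scales_lebesgue (block_mx 1%:M w 0 1%:M : 'M[R]_(1 + n)).
Proof.
move=> B mB; rewrite det_ublock !det1 mulr1 normr1.
apply: lebesgue_rV_slice1 => //; first exact: measurable_linear_preimage.
move=> t; rewrite mul1e -[RHS](lebesgue_rV_translation (t *: w)); last exact: measurable_slice1.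
congr (mu n _)%E; apply/funext => y /=; congr B.
by rewrite !rV_consE mul_row_block !mulmx1 !mulmx0 addr0 mul_scalar_mx addrC.
Qed.

Lemma scales_lebesgue_dl n (v : 'cV[R]_n) :
  scales_lebesgue (block_mx 1%:M 0 v 1%:M : 'M[R]_(1 + n)).
Proof.
move=> B mB; rewrite det_lblock !det1 mulr1 normr1.
apply: lebesgue_rV_slice2 => //; first exact: measurable_linear_preimage.
move=> y; rewrite mul1e.
rewrite -[RHS](@lebesgue_measure_affine R 1 ((y *m v) 0 0) _ (oner_neq0 _)); last exact: measurable_slice2.
rewrite normr1 mul1e; congr (leb _)%E; apply/funext => t /=; congr B.
rewrite !rV_consE mul_row_block !mulmx1 !mulmx0 add0r mul1r.
by rewrite [y *m v]mx11_scalar -raddfD !mxE.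
Qed.

(** Gaussian elimination by induction on the size: with a nonzero pivot the matrix is a product of
    shears, a scaling of the first coordinate and a smaller invertible block; a zero pivot is first
    repaired by a row operation. *)
Lemma scales_lebesgue_unitmx n (A : 'M[R]_n) : A \in unitmx -> scales_lebesgue A.
Proof.
elim: n A => [|n IH] A uA.
  move=> B mB; rewrite det_mx00 normr1 mul1e; congr (mu 0 _).
  by apply/funext => x /=; congr B; rewrite [RHS]thinmx0 [LHS]thinmx0.
have pivot (A' : 'M[R]_(1 + n)) : A' \in unitmx -> A' 0 0 != 0 -> scales_lebesgue A'.
  move=> uA' a0; set a := A' 0 0 in a0.
  pose b := ursubmx A'; pose c := dlsubmx A'; pose D := drsubmx A'.
  (* [S] is the Schur complement of the pivot; it is invertible because the determinant of [A'] is
     [a] times that of [S]. *)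
  pose S := D - a^-1 *: (c *m b).
  have E : A' = block_mx 1%:M 0 (a^-1 *: c) 1%:M *m block_mx a%:M 0 0 1%:M
      *m block_mx 1%:M 0 0 S *m block_mx 1%:M (a^-1 *: b) 0 1%:M.
    rewrite !mulmx_block !(mulmx0, mul0mx, mulmx1, mul1mx, addr0, add0r).
    rewrite -[LHS]submxK; congr block_mx.
    - by rewrite [ulsubmx A']mx11_scalar !mxE !lshift0.
    - by rewrite mul_scalar_mx scalerA divff// scale1r.
    - by rewrite mul_mx_scalar scalerA divff// scale1r.
    - rewrite mul_mx_scalar scalerA divff// scale1r -scalemxAr /S addrC subrK//.
  have uS : S \in unitmx.
    move: uA'; rewrite !unitmxE !unitfE [in \det A']E !det_mulmx !det_ublock !det_lblock.
    by rewrite !det1 det_scalar1 !mulr1 !mul1r; apply: contra_neq => ->; rewrite mulr0.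
  rewrite E; apply: scales_lebesgueM; last exact: scales_lebesgue_ur.
  apply: scales_lebesgueM; last by apply: scales_lebesgue_dr; exact: IH.
  apply: scales_lebesgueM; last exact: scales_lebesgue_ul.
  exact: scales_lebesgue_dl.
have [a0|] := eqVneq (A 0 0) 0; last exact: pivot.
have [j Aj0] : exists j : 'I_n, A (lift 0 j) 0 != 0.
  apply/existsP; apply: contraT; rewrite negb_exists => /forallP A0.
  have /matrixP/(_ 0 0) := mulVmx uA; rewrite !mxE big1 => [/esym/eqP|k _].
    by rewrite oner_eq0.
  have [k' ->|->] := unliftP 0 k; last by rewrite a0 mulr0.
  by have := A0 k'; rewrite negbK => /eqP ->; rewrite mulr0.
(* Multiplying by [U (delta_mx 0 j)] adds the row with nonzero first entry to the top row, which
   creates a pivot; [U (- delta_mx 0 j)] undoes this. *)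
pose U (w : 'rV[R]_n) : 'M[R]_(1 + n) := block_mx 1%:M w 0 1%:M.
have UU w w' : U w *m U w' = U (w + w').
  by rewrite /U mulmx_block !(mulmx0, mul0mx, mulmx1, mul1mx, addr0, add0r) addrC.
have U0 : U 0 = 1%:M by rewrite /U -scalar_mx_block.
have uU w : U w \in unitmx by rewrite unitmxE det_ublock !det1 mulr1 unitr1.
rewrite -[A](mul1mx A : 1%:M *m (A : 'M[R]_(1 + n)) = _) -U0 -(addNr (delta_mx 0 j)) -UU -mulmxA.
apply: scales_lebesgueM; first exact: scales_lebesgue_ur.
apply: pivot; first by rewrite unitmx_mul uU.
have -> : U (delta_mx 0 j) *m (A : 'M[R]_(1 + n)) =
    col_mx (usubmx (A : 'M[R]_(1 + n)) + row j (dsubmx (A : 'M[R]_(1 + n))))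
           (dsubmx (A : 'M[R]_(1 + n))).
  rewrite -[in LHS](vsubmxK (A : 'M[R]_(1 + n))) /U mul_block_col.
  by rewrite !mul1mx mul0mx add0r rowE.
rewrite -(lshift0 n 0) col_mxEu !mxE lshift0 a0 add0r.
by move: Aj0; congr (A _ _ != 0); apply/val_inj; rewrite /= /bump add1n.
Qed.

Lemma lebesgue_rV_affine n (A : 'M[R]_n) (c : 'rV[R]_n) (B : set 'rV[R]_n) :
  A \in unitmx -> measurable B ->
  (`|\det A|%:E * mu n [set x | B (x *m A + c)%R] = mu n B)%E.
Proof.
move=> uA mB; rewrite -(lebesgue_rV_translation c mB).
by apply: scales_lebesgue_unitmx => //; exact: measurable_translation_preimage.
Qed.

Lemma measurable_dotv n (p : 'rV[R]_n) :
  measurable_fun [set: 'rV[R]_n] (dotv p : 'rV[R]_n -> measurableTypeR R).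
Proof.
apply: measurable_sum => k; apply: measurable_funM; first exact: measurable_cst.
exact: measurable_rV_coord.
Qed.

Definition hyperplane n (p : 'rV[R]_n) (c : R) : set 'rV[R]_n :=
  [set x | dotv p x = c].

Lemma measurable_hyperplane n (p : 'rV[R]_n) (c : R) : measurable (hyperplane p c).
Proof.
have -> : hyperplane p c = dotv p @^-1` [set c] by [].
by rewrite -[X in measurable X]setTI; apply: measurable_dotv.
Qed.

Lemma dotv_rV_cons n (p : 'rV[R]_n.+1) t y :
  dotv p (rV_cons (t, y)) = p 0 0 * t + dotv (\row_j p 0 (lift 0 j)) y.
Proof.
rewrite /dotv big_ord_recl !mxE unlift_none; congr (_ + _).
by apply: eq_bigr => j _; rewrite !mxE liftK.
Qed.

(** If the first coefficient vanishes, slices at fixed first coordinate are hyperplanes of lower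
    dimension; otherwise slices along the first coordinate are single points. *)
Lemma lebesgue_rV_hyperplane n (p : 'rV[R]_n) (c : R) : p != 0 ->
  mu n (hyperplane p c) = 0%E.
Proof.
elim: n p c => [|n IH] p c p0; first by rewrite [p]thinmx0 eqxx in p0.
have [p00|p00] := eqVneq (p 0 0) 0.
  rewrite lebesgue_rVS1 integral0_eq// => t _.
  rewrite -[RHS](IH (\row_j p 0 (lift 0 j)) c).
    congr (mu n _); apply/seteqP.
    by split => y; rewrite /xsection/= inE /= /hyperplane/= dotv_rV_cons p00 mul0r add0r.
  apply: contra_neq p0 => q0; apply/rowP => i; rewrite mxE.
  have [j ->|->] := unliftP ord0 i; last by [].
  by have /rowP/(_ j) := q0; rewrite !mxE.
rewrite lebesgue_rVS2; last exact: measurable_hyperplane.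
rewrite integral0_eq// => y _.
have -> : ysection (@rV_cons R n @^-1` hyperplane p c) y
    = [set (c - dotv (\row_j p 0 (lift 0 j)) y) / p 0 0].
  apply/seteqP; split => t; rewrite /ysection/= inE/= /hyperplane/= dotv_rV_cons.
    by move=> <-; rewrite addrK mulrC mulKf.
  by move=> ->; rewrite mulrC divfK// subrK.
exact: lebesgue_measure_set1.
Qed.

End affine_change_of_variables.

(** * Affine functions and barycentric coordinates *)

Section dot_product.
Context {R : realType} {n : nat}.
Implicit Types x y z : 'rV[R]_n.

Lemma dotvC x y : dotv x y = dotv y x.
Proof. by apply: eq_bigr => j _; rewrite mulrC. Qed.

Lemma dotv_mx x y : dotv x y = (x *m y^T) 0 0.
Proof. by rewrite mxE; apply: eq_bigr => j _; rewrite mxE. Qed.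

Lemma dotvDr x y z : dotv x (y + z) = dotv x y + dotv x z.
Proof. by rewrite -big_split; apply: eq_bigr => j _; rewrite mxE mulrDr. Qed.

Lemma dotvZr a x y : dotv x (a *: y) = a * dotv x y.
Proof. by rewrite mulr_sumr; apply: eq_bigr => j _; rewrite mxE mulrCA. Qed.

Lemma dotv0r x : dotv x 0 = 0.
Proof. by rewrite /dotv big1// => j _; rewrite mxE mulr0. Qed.

Lemma dotvNr x y : dotv x (- y) = - dotv x y.
Proof. by rewrite -scaleN1r dotvZr mulN1r. Qed.

Lemma dotvBr x y z : dotv x (y - z) = dotv x y - dotv x z.
Proof. by rewrite dotvDr dotvNr. Qed.

Lemma dotv_sumr x I (r : seq I) (P : pred I) (F : I -> 'rV[R]_n) :
  dotv x (\sum_(i <- r | P i) F i) = \sum_(i <- r | P i) dotv x (F i).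
Proof.
elim/big_rec2 : _ => [|i a b _ <-]; first by rewrite dotv0r.
by rewrite dotvDr.
Qed.

Lemma dotvDl x y z : dotv (y + z) x = dotv y x + dotv z x.
Proof. by rewrite !(dotvC _ x) dotvDr. Qed.

Lemma dotvZl a x y : dotv (a *: x) y = a * dotv x y.
Proof. by rewrite !(dotvC _ y) dotvZr. Qed.

Lemma dotv0l x : dotv 0 x = 0.
Proof. by rewrite dotvC dotv0r. Qed.

Lemma dotvBl x y z : dotv (y - z) x = dotv y x - dotv z x.
Proof. by rewrite !(dotvC _ x) dotvBr. Qed.

Lemma dotv_suml x I (r : seq I) (P : pred I) (F : I -> 'rV[R]_n) :
  dotv (\sum_(i <- r | P i) F i) x = \sum_(i <- r | P i) dotv (F i) x.
Proof. by rewrite dotvC dotv_sumr; apply: eq_bigr => i _; rewrite dotvC. Qed.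

Lemma dotv_ge0 x : 0 <= dotv x x.
Proof. by apply: sumr_ge0 => j _; rewrite -expr2 sqr_ge0. Qed.

Lemma dotv_eq0 x : (dotv x x == 0) = (x == 0).
Proof.
apply/idP/eqP => [|->]; last by rewrite dotv0r.
rewrite psumr_eq0 => [/allP x0|j _]; last by rewrite -expr2 sqr_ge0.
apply/rowP => j; have := x0 j (mem_index_enum _).
by rewrite -expr2 sqrf_eq0 => /eqP ->; rewrite mxE.
Qed.

Lemma dotv_gt0 x : (0 < dotv x x) = (x != 0).
Proof. by rewrite lt_def dotv_ge0 andbT dotv_eq0. Qed.

End dot_product.

Section affine_functions.
Context {R : realType} {n : nat}.
Implicit Types p q : 'rV[R]_n -> R.

(* [affine_fun] in any dimension: the reference simplex of a side of an interval
   has dimension 0. *)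
Definition affine_form p : Prop :=
  exists (a : R) (g : 'rV[R]_n), forall x, p x = a + dotv g x.

Lemma affine_cst (a : R) : affine_form (fun=> a).
Proof. by exists a, 0 => x; rewrite dotv0l addr0. Qed.

Lemma affine_add p q : affine_form p -> affine_form q ->
  affine_form (fun x => p x + q x).
Proof.
move=> [a [g pE]] [b [h qE]]; exists (a + b), (g + h) => x.
by rewrite pE qE dotvDl; ring.
Qed.

Lemma affine_scale (c : R) p : affine_form p -> affine_form (fun x => c * p x).
Proof.
move=> [a [g pE]]; exists (c * a), (c *: g) => x.
by rewrite pE dotvZl; ring.
Qed.

Lemma affine_sub p q : affine_form p -> affine_form q ->
  affine_form (fun x => p x - q x).
Proof.
move=> [a [g pE]] [b [h qE]]; exists (a - b), (g - h) => x.
by rewrite pE qE dotvBl; ring.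
Qed.

Lemma affine_sum I (r : seq I) (P : pred I) (F : I -> 'rV[R]_n -> R) :
  (forall i, affine_form (F i)) ->
  affine_form (fun x => \sum_(i <- r | P i) F i x).
Proof.
move=> aF; elim: r => [|i r IH].
  by have [a [g E]] := affine_cst 0; exists a, g => x; rewrite big_nil; exact: (E x).
have [Pi|nPi] := boolP (P i).
  have [a [g E]] := affine_add (aF i) IH.
  by exists a, g => x; rewrite big_cons Pi E.
by have [a [g E]] := IH; exists a, g => x; rewrite big_cons (negbTE nPi) E.
Qed.

Lemma affine_comb p (I : finType) (l : I -> R) (a : I -> 'rV[R]_n) :
  affine_form p -> \sum_i l i = 1 ->
  p (\sum_i l i *: a i) = \sum_i l i * p (a i).
Proof.
move=> [b [g pE]] l1; rewrite pE dotv_sumr.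
under [RHS]eq_bigr => i _ do rewrite pE mulrDr -dotvZr.
by rewrite big_split/= -mulr_suml l1 mul1r.
Qed.

Lemma affine_barycenter p k (s : 'I_k.+1 -> 'rV[R]_n) : affine_form p ->
  p (barycenter s) = k.+1%:R^-1 * \sum_i p (s i).
Proof.
move=> ap; rewrite /barycenter scaler_sumr affine_comb// ?mulr_sumr//.
by rewrite sumr_const card_ord -[LHS]mulr_natl divff// pnatr_eq0.
Qed.

Lemma measurable_affine_form p : affine_form p ->
  measurable_fun [set: 'rV[R]_n] (p : 'rV[R]_n -> measurableTypeR R).
Proof.
move=> [a [g pE]]; rewrite (_ : p = (fun x => a + dotv g x)); last exact/funext.
by apply: measurable_funD; [exact: measurable_cst|exact: measurable_dotv].
Qed.

End affine_functions.

Section rank_one.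
Context {R : realType} {n : nat}.
Implicit Types g w : 'rV[R]_n.

(** Matrix determinant lemma: [E] equates two block-triangular factorisations of one matrix. *)
Lemma det_rank_one g w : \det (1%:M + g^T *m w) = 1 + dotv g w.
Proof.
have E : block_mx 1%:M 0 g^T 1%:M *m block_mx 1%:M (- w) 0 (1%:M + g^T *m w) =
   block_mx (1%:M + w *m g^T) (- w) 0 1%:M *m block_mx 1%:M 0 g^T 1%:M
   :> 'M[R]_(1 + n).
  rewrite !mulmx_block !(mulmx0, mul0mx, mulmx1, mul1mx, addr0, add0r).
  by rewrite mulmxN mulNmx addrK addrCA addNr addr0.
have := congr1 determinant E.
rewrite !det_mulmx !det_ublock !det_lblock !det1 !mulr1 !mul1r => ->.
by rewrite det_mx11 !mxE eqxx; congr (_ + _); apply: eq_bigr => j _; rewrite mxE mulrC.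
Qed.

Lemma mulmx_rank_one g w b (x : 'rV[R]_n) :
  x *m (1%:M + g^T *m w) + b *: w = x + (b + dotv g x) *: w.
Proof.
rewrite mulmxDr mulmx1 mulmxA [x *m g^T]mx11_scalar mul_scalar_mx -dotv_mx dotvC.
by rewrite -addrA -scalerDl [_ + b]addrC.
Qed.

(** The exchange of two vertices of a simplex and [face_map] both have this form. *)
Lemma lebesgue_rV_rank_one g w (b : R) (B : set 'rV[R]_n) :
  1 + dotv g w != 0 -> measurable B ->
  (`|1 + dotv g w|%:E * lebesgue_rV n [set x | B (x + (b + dotv g x) *: w)%R]
   = lebesgue_rV n B)%E.
Proof.
move=> gw mB; rewrite -det_rank_one.
rewrite -(@lebesgue_rV_affine R n (1%:M + g^T *m w) (b *: w) B)//; last first.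
  by rewrite unitmxE unitfE det_rank_one.
congr (_ * lebesgue_rV n _)%E; apply/funext => x /=; congr B.
by rewrite mulmx_rank_one.
Qed.

End rank_one.

Section barycentric.
Context {R : realType} {k : nat} (s : 'I_k.+1 -> 'rV[R]_k).

Definition homog (x : 'rV[R]_k) : 'rV[R]_(1 + k) := row_mx 1%:M x.

(** The rows are the homogeneous coordinates (1, s i). Barycentric coordinates of [x] solve
    [l *m vertex_mx = homog x], so affine independence amounts to invertibility. *)
Definition vertex_mx : 'M[R]_(1 + k) :=
  row_mx (const_mx 1) (\matrix_i s i).

Definition bary (i : 'I_k.+1) (x : 'rV[R]_k) : R :=
  (homog x *m invmx vertex_mx) 0 i.

Definition bary_const (i : 'I_k.+1) : R := bary i 0.

Definition bary_grad (i : 'I_k.+1) : 'rV[R]_k :=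
  \row_j invmx vertex_mx (rshift 1 j) i.

Lemma homog_comb (l : 'rV[R]_(1 + k)) :
  l *m vertex_mx = row_mx (\sum_i l 0 i)%:M (\sum_i l 0 i *: s i).
Proof.
rewrite /vertex_mx mul_mx_row; congr row_mx.
  by apply/rowP => j; rewrite (ord1 j) !mxE; apply: eq_bigr => i _; rewrite mxE mulr1.
by rewrite mulmx_sum_row; apply: eq_bigr => i _; rewrite rowK.
Qed.

Lemma row_vertex_mx i : row i vertex_mx = homog (s i).
Proof.
rewrite /vertex_mx row_row_mx rowK; congr row_mx.
by apply/rowP => j; rewrite (ord1 j) !mxE.
Qed.

Lemma baryE i x :
  bary i x = bary_const i + dotv (bary_grad i) x.
Proof.
suff E y : bary i y = invmx vertex_mx 0 i + dotv (bary_grad i) y.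
  by rewrite /bary_const !E dotv0r addr0.
rewrite /bary mxE big_ord_recl; congr (_ + _).
  have -> : homog y 0 (ord0 : 'I_(1 + k)) = 1.
    by rewrite /homog mxE; case: splitP => // j _; rewrite (ord1 j) mxE.
  by rewrite mul1r.
apply: eq_bigr => j _; have -> : lift ord0 j = rshift 1 j by exact: val_inj.
have -> : homog y 0 (rshift 1 j) = y 0 j.
  by rewrite /homog mxE; case: splitP => [[[]]//|j' /addnI/val_inj->].
by rewrite mxE mulrC.
Qed.

Lemma affine_bary i : affine_form (bary i).
Proof. by exists (bary_const i), (bary_grad i) => x; exact: baryE. Qed.

Lemma baryD i x v : bary i (x + v) = bary i x + dotv (bary_grad i) v.
Proof. by rewrite !baryE dotvDr addrA. Qed.

Hypothesis indep : affinely_independent s.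

Lemma vertex_mx_unit : vertex_mx \in unitmx.
Proof.
rewrite -row_free_unit; apply: inj_row_free => l.
rewrite homog_comb -[X in _ = X -> _]row_mx0.
move=> /eq_row_mx[/(congr1 (fun A : 'M[R]_1 => A 0 0))].
rewrite !mxE eqxx mulr1n => l0 ls.
by apply/rowP => i; rewrite mxE; exact: (indep l0 ls).
Qed.

Lemma bary_homog x : ((\row_i bary i x) : 'rV[R]_(1 + k)) *m vertex_mx = homog x.
Proof.
rewrite (_ : \row_i _ = homog x *m invmx vertex_mx) ?mulmxKV ?vertex_mx_unit//.
by apply/rowP => i; rewrite mxE.
Qed.

Lemma sum_bary x : \sum_i bary i x = 1.
Proof.
have := bary_homog x; rewrite homog_comb => /eq_row_mx[/(congr1 (fun A : 'M[R]_1 => A 0 0))].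
by rewrite !mxE eqxx !mulr1n => + _; under eq_bigr do rewrite mxE.
Qed.

Lemma bary_comb x : \sum_i bary i x *: s i = x.
Proof.
have := bary_homog x; rewrite homog_comb => /eq_row_mx[_].
by under eq_bigr do rewrite mxE.
Qed.

Lemma bary_vertex i j : bary i (s j) = (i == j)%:R.
Proof.
rewrite /bary -row_vertex_mx -row_mul mulmxV ?vertex_mx_unit//.
by rewrite !mxE eq_sym.
Qed.

Lemma affine_baryE (p : 'rV[R]_k -> R) x : affine_form p ->
  p x = \sum_i p (s i) * bary i x.
Proof.
move=> ap; rewrite -{1}[x]bary_comb affine_comb ?sum_bary//.
by apply: eq_bigr => i _; rewrite mulrC.
Qed.

Lemma bary_grad_diff i j l :
  dotv (bary_grad i) (s j - s l) = (i == j)%:R - (i == l)%:R.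
Proof.
by rewrite dotvBr -!bary_vertex !baryE; ring.
Qed.

(** The coordinates sum to the constant 1, so the sum of gradients is orthogonal to every vector, in
    particular to itself. *)
Lemma sum_bary_grad : \sum_i bary_grad i = 0.
Proof.
apply/eqP; rewrite -dotv_eq0; apply/eqP; set v := \sum_i _.
have := sum_bary v; under eq_bigr do rewrite -[X in bary _ X]add0r baryD.
rewrite big_split/= sum_bary -dotv_suml => /eqP.
by rewrite -subr_eq0 addrAC subrr add0r => /eqP.
Qed.

Lemma bary_grad_basis x : x = \sum_i dotv (bary_grad i) x *: s i.
Proof.
have := bary_comb x; under eq_bigr do rewrite -[X in bary _ X]add0r baryD scalerDl.
by rewrite big_split/= bary_comb add0r => ->.
Qed.

Lemma bary_grad_neq0 i : (0 < k)%N -> bary_grad i != 0.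
Proof.
move=> k0; have [j ji] : exists j, j != i.
  have [->|i0] := eqVneq i 0; last by exists 0; rewrite eq_sym.
  exists ord_max; apply/eqP => /(congr1 val)/= E; by rewrite E in k0.
apply: contraTneq isT => g0; have := bary_grad_diff i i j.
by rewrite g0 dotv0l eqxx eq_sym (negbTE ji) subr0 => /eqP; rewrite eq_sym oner_eq0.
Qed.

Lemma simplex_baryE : convex_hull (range s) = [set x | forall i, 0 <= bary i x].
Proof.
apply/seteqP; split => [x [m [a [l [sa l0 l1 ->]]]] i|x x0].
  rewrite /= affine_comb//; last exact: affine_bary.
  apply: sumr_ge0 => j _; apply: mulr_ge0 => //.
  by have [j' _ <-] := sa j; rewrite bary_vertex ler0n.
exists k.+1, s, (bary^~ x); split => //; first exact: sum_bary.
by rewrite bary_comb.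
Qed.

Lemma bary_le1 i x : convex_hull (range s) x -> bary i x <= 1.
Proof.
rewrite simplex_baryE => x0; rewrite -(sum_bary x) (bigD1 i)//= lerDl.
by apply: sumr_ge0 => j _; exact: x0.
Qed.

Lemma vertex_inj : injective s.
Proof.
move=> i j ij; have := bary_vertex i j; rewrite -ij bary_vertex eqxx.
by case: eqP => // _ /eqP; rewrite oner_eq0.
Qed.

(** The i-th coordinate vanishes at all vertices but [s i], hence on the hull of any set of vertices
    omitting [s i]. *)
Lemma convex_hull_face (A : set 'rV[R]_k) x i : A `<=` range s ->
  convex_hull A x -> bary i x != 0 -> A (s i).
Proof.
move=> As [m [a [l [Aa l0 l1 ->]]]].
rewrite affine_comb//; last exact: affine_bary.
apply: contra_neqP => nA; apply: big1 => j _.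
have [j' _ E] := As _ (Aa j); rewrite -E bary_vertex; case: eqP => [ij|]; last by rewrite mulr0.
by case: nA; rewrite ij E.
Qed.

(** The i-th coordinate is at most 1 on the simplex, and a convex combination reaches 1 only through
    points where it equals 1; [s i] is the only such point. *)
Lemma vertex_extreme (A : set 'rV[R]_k) i : A `<=` convex_hull (range s) ->
  convex_hull A (s i) -> A (s i).
Proof.
move=> As [m [a [l [Aa l0 l1 E]]]].
have : \sum_j l j * (1 - bary i (a j)) = 0.
  have := bary_vertex i i; rewrite E eqxx affine_comb//; last exact: affine_bary.
  under [in X in _ -> X]eq_bigr do rewrite mulrBr mulr1.
  by rewrite sumrB l1 => ->; rewrite subrr.
have nn j : 0 <= l j * (1 - bary i (a j)).
  by apply: mulr_ge0 => //; rewrite subr_ge0; exact/bary_le1/As.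
move/eqP; rewrite psumr_eq0// => /allP l_eq.
have [j lj0] : exists j, l j != 0.
  apply/existsP; apply: contraTT isT; rewrite negb_exists => /forallP l00.
  move/eqP: l1; rewrite big1 ?(eq_sym 0) ?oner_eq0// => j _.
  by apply/eqP; have := l00 j; rewrite negbK.
have aj1 : bary i (a j) = 1.
  have := l_eq j (mem_index_enum _); rewrite mulf_eq0 (negbTE lj0)/= subr_eq0.
  by move=> /eqP.
suff -> : s i = a j by exact: Aa.
rewrite -[RHS]bary_comb (bigD1 i)//= aj1 scale1r big1 ?addr0// => m' m'i.
have := sum_bary (a j); rewrite (bigD1 i)//= aj1 => /eqP.
rewrite -subr_eq0 addrAC subrr add0r psumr_eq0 => [/allP/(_ m' (mem_index_enum _))|m'' _].
  by rewrite m'i/= => /eqP ->; rewrite scale0r.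
by have := As _ (Aa j); rewrite simplex_baryE; exact.
Qed.

End barycentric.

(** * Integration over a simplex *)

Section affine_continuity.
Context {R : realType} {n : nat}.

Lemma continuous_affine_form (p : 'rV[R]_n -> R) : affine_form p -> continuous p.
Proof.
move=> [a [g pE]]; rewrite (_ : p = (fun x => a + \sum_j g 0 j * x 0 j)); last exact/funext.
move=> x; apply: (@cvgD _ _ _ (nbhs x) _ (fun=> a)); first exact: cvg_cst.
apply: (@cvg_big _ _ +%R 0 xpredT _ _ (nbhs x) _ (fun j (y : 'rV[R]_n) => g 0 j * y 0 j)).
  exact: add_continuous.
move=> j _; apply: (@cvgM _ _ (nbhs x) _ (fun=> g 0 j)); first exact: cvg_cst.
exact: coord_continuous.
Qed.

Definition open_box (x : 'rV[R]_n) (e : R) : set 'rV[R]_n :=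
  [set y | forall j, `]x 0 j - e, x 0 j + e[%classic (y 0 j)].

Lemma measurable_open_box x e : measurable (open_box x e).
Proof.
rewrite (_ : open_box x e = \bigcap_(j in [set: 'I_n])
    (rV_coord j @^-1` `]x 0 j - e, x 0 j + e[%classic)).
  apply: fin_bigcap_measurable => // j _.
  by rewrite -[X in measurable X]setTI; exact: measurable_rV_coord.
by apply/seteqP; split=> [y yA j _|y yA j]; exact: yA.
Qed.

Lemma lebesgue_rV_open_box (x : 'rV[R]_n) (e : R) : 0 < e ->
  (0 < lebesgue_rV n (open_box x e) < +oo)%E.
Proof.
move=> e0; rewrite (@lebesgue_rV_box R n (fun j => `]x 0 j - e, x 0 j + e[%classic))//.
rewrite (_ : (\prod_(j < n) _)%E = (\prod_(j < n) (e + e))%:E).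
  by rewrite ltry lte_fin andbT prodr_gt0// => j _; rewrite addr_gt0.
rewrite -prodEFin; apply: eq_bigr => j _.
rewrite lebesgue_measure_itv/= lte_fin ifT; last by lra.
by rewrite -EFinD; congr EFin; lra.
Qed.

Lemma lebesgue_rV_nbhs_gt0 (x : 'rV[R]_n) (A : set 'rV[R]_n) :
  measurable A -> nbhs x A -> (0 < lebesgue_rV n A)%E.
Proof.
move=> mA /nbhs_ballP[e /= e0 eA].
have /andP[H _] := lebesgue_rV_open_box x e0.
apply: (lt_le_trans H); apply: le_measure; rewrite ?inE//.
  exact: measurable_open_box.
move=> y /= yx; apply: eA; split => // i j /=; rewrite (ord1 i).
have /= := yx j; rewrite in_itv/= => /andP[? ?].
by rewrite /ball/= ltr_distlC; apply/andP; split; lra.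
Qed.

End affine_continuity.

Section simplex_measure.
Context {R : realType} {k : nat} (s : 'I_k.+1 -> 'rV[R]_k).
Hypothesis indep : affinely_independent s.
Local Notation mu := (lebesgue_rV k).
Local Notation simplex := (convex_hull (range s)).

Lemma measurable_simplex : measurable simplex.
Proof.
rewrite simplex_baryE//.
rewrite (_ : mkset _ = \bigcap_(i in [set: 'I_k.+1]) (bary s i @^-1` `[0, +oo[%classic)).
  apply: fin_bigcap_measurable => // i _; rewrite -[X in measurable X]setTI.
  by apply: (measurable_affine_form (affine_bary s i)) => //; exact: measurable_itv.
apply/seteqP; split=> [x x0 i _|x x0 i] /=; first by rewrite in_itv/= andbT; exact: x0.
by have := x0 i I; rewrite /= in_itv/= andbT.
Qed.

Lemma simplex_interior x : (forall i, 0 < bary s i x) -> nbhs x simplex.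
Proof.
move=> x0; rewrite simplex_baryE//.
suff : \forall y \near x, forall i, 0 < bary s i y.
  by apply: filterS => y y0 i; exact/ltW.
apply: (@filter_forall _ _ (fun i y => 0 < bary s i y) (nbhs x)) => i.
have /cvgr_gt := continuous_affine_form (affine_bary s i) (x := x).
by apply; exact: x0.
Qed.

Lemma bary_barycenter i : bary s i (barycenter s) = k.+1%:R^-1.
Proof.
rewrite affine_barycenter; last exact: affine_bary.
rewrite (bigD1 i)//= big1 => [|j ji]; rewrite bary_vertex// ?eqxx ?addr0 ?mulr1//.
by rewrite eq_sym (negbTE ji).
Qed.

Lemma simplex_measure_gt0 : (0 < mu simplex)%E.
Proof.
apply: (@lebesgue_rV_nbhs_gt0 _ _ (barycenter s)); first exact: measurable_simplex.
by apply: simplex_interior => i; rewrite bary_barycenter invr_gt0.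
Qed.

Lemma simplex_measure_lty : (mu simplex < +oo)%E.
Proof.
(* Coordinates of a convex combination are bounded by the double sum; the added 1 makes the
   inequality strict and the box nonempty. *)
pose K := 1 + \sum_i \sum_j `|s i 0 j|.
have K0 : 0 < K.
  by rewrite ltr_pwDl// sumr_ge0// => i _; rewrite sumr_ge0.
have /andP[_] := lebesgue_rV_open_box (0 : 'rV[R]_k) K0; apply: le_lt_trans.
apply: le_measure; rewrite ?inE; first exact: measurable_simplex.
  exact: measurable_open_box.
move=> x sx j /=; rewrite in_itv/= mxE !add0r -ltr_norml.
rewrite -[x](bary_comb indep) summxE; apply: (le_lt_trans (ler_norm_sum _ _ _)).
apply: (@le_lt_trans _ _ (\sum_i \sum_j `|s i 0 j|)); last by rewrite /K; lra.
apply: ler_sum => i _; rewrite mxE normrM (bigD1 j)//=.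
have b0 : 0 <= bary s i x by move: sx; rewrite simplex_baryE//; exact.
rewrite ger0_norm//.
apply: (@le_trans _ _ `|s i 0 j|); last by rewrite lerDl sumr_ge0.
by rewrite ler_piMl//; exact: bary_le1.
Qed.

Definition volume : R := fine (mu simplex).

Lemma volume_gt0 : 0 < volume.
Proof. by apply: fine_gt0; rewrite simplex_measure_gt0 simplex_measure_lty. Qed.

Lemma volumeE : mu simplex = volume%:E.
Proof.
rewrite /volume fineK// fin_numE -ltey -ltNye simplex_measure_lty.
by rewrite (lt_trans _ simplex_measure_gt0).
Qed.

Lemma measurable_bary i (D : set 'rV[R]_k) :
  measurable_fun D (fun x => (bary s i x)%:E).
Proof.
apply/measurable_EFinP; apply: measurable_funS (measurable_affine_form (affine_bary s i)) => //.
Qed.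

(* The affine map exchanging the i-th and j-th vertices preserves the volume and
   exchanges the corresponding barycentric coordinates. *)
Lemma integral_bary_swap i j :
  (\int[mu]_(x in simplex) (bary s i x)%:E = \int[mu]_(x in simplex) (bary s j x)%:E)%E.
Proof.
have [->//|ij] := eqVneq i j.
pose g := bary_grad s i - bary_grad s j; pose w := s j - s i.
pose b := bary_const s i - bary_const s j.
pose f := fun x : 'rV[R]_k => x + (b + dotv g x) *: w.
have fE x : f x = x + (bary s i x - bary s j x) *: w.
  by rewrite /f !baryE /b /g dotvBl; congr (_ + _ *: _); rewrite opprD addrACA.
(* This is the determinant of the exchange, whose absolute value 1 gives invariance of the
   volume. *)
have gw : 1 + dotv g w = -1.
  by rewrite /g /w dotvBl !bary_grad_diff// !eqxx [j == i]eq_sym (negbTE ij) mulr1n mulr0n; ring.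
have baryf l x : bary s l (f x) =
    bary s l x + (bary s i x - bary s j x) * ((l == j)%:R - (l == i)%:R).
  by rewrite fE baryD dotvZr /w bary_grad_diff.
have bi x : bary s i (f x) = bary s j x.
  by rewrite baryf eqxx (negbTE ij) mulr1n mulr0n; ring.
have bj x : bary s j (f x) = bary s i x.
  by rewrite baryf eqxx [j == i]eq_sym (negbTE ij) mulr1n mulr0n; ring.
have mf : measurable_fun [set: 'rV[R]_k] f.
  have := measurable_affine_rV (1%:M + g^T *m w) (b *: w).
  congr measurable_fun; apply/funext => x.
  exact: mulmx_rank_one.
have fS : f @^-1` simplex = simplex.
  rewrite simplex_baryE//; apply/seteqP; split => x x0 l /=.
    have [->|li] := eqVneq l i; first by rewrite -bj; exact: x0.
    have [->|lj] := eqVneq l j; first by rewrite -bi; exact: x0.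
    by have := x0 l; rewrite /= baryf (negbTE li) (negbTE lj) subrr mulr0 addr0.
  have [->|li] := eqVneq l i; first by rewrite bi; exact: x0.
  have [->|lj] := eqVneq l j; first by rewrite bj; exact: x0.
  by rewrite baryf (negbTE li) (negbTE lj) subrr mulr0 addr0; exact: x0.
transitivity (\int[pushforward mu f]_(x in simplex) (bary s i x)%:E)%E.
  apply/esym/eq_measure_integral => A mA _.
  rewrite -[RHS](@lebesgue_rV_rank_one _ _ g w b A)//; last by rewrite gw oppr_eq0 oner_eq0.
  by rewrite gw normrN1 mul1e.
rewrite ge0_integral_pushforward//; first 1 last.
- exact: measurable_simplex.
- exact: measurable_bary.
- by move=> x; rewrite inE lee_fin simplex_baryE//; exact.
by rewrite fS; apply: eq_integral => x _ /=; rewrite bi.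
Qed.

(** The k+1 integrals agree by symmetry and add up to the volume. An infinite common value is
    excluded because the volume is finite. *)
Lemma integral_bary i :
  (\int[mu]_(x in simplex) (bary s i x)%:E = (k.+1%:R^-1 * volume)%:E)%E.
Proof.
have b0 j x : simplex x -> (0 <= (bary s j x)%:E)%E.
  by rewrite lee_fin simplex_baryE//; exact.
have : (\int[mu]_(x in simplex) \sum_(j < k.+1) (bary s j x)%:E = volume%:E)%E.
  rewrite -volumeE -[RHS]mul1e -integral_cst; last exact: measurable_simplex.
  by apply: eq_integral => x _; rewrite sumEFin sum_bary.
rewrite ge0_integral_sum//; first 1 last.
- exact: measurable_simplex.
- by move=> j; exact: measurable_bary.
under eq_bigr do rewrite (integral_bary_swap _ i).
have := @integral_ge0 _ _ _ mu simplex _ (b0 i).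
set J := (\int[mu]_(x in simplex) (bary s i x)%:E)%E.
case: J => [r _|_|//]; last first.
  rewrite big_ord_recl addye// gt_eqF// (lt_le_trans ltNy0)//.
  by apply: sume_ge0.
rewrite sumEFin sumr_const card_ord => -[<-].
by rewrite -[r *+ _]mulr_natl mulKf// pnatr_eq0.
Qed.

Lemma integrable_bary i : mu.-integrable simplex (fun x => (bary s i x)%:E).
Proof.
apply/integrableP; split; first exact: measurable_bary.
rewrite (@eq_integral _ _ _ mu simplex (fun x => (bary s i x)%:E)) => [|x].
  by rewrite integral_bary ltry.
by rewrite inE simplex_baryE// => x0; rewrite gee0_abs// lee_fin; exact: x0.
Qed.

Lemma integrable_affine (p : 'rV[R]_k -> R) : affine_form p ->
  mu.-integrable simplex (fun x => (p x)%:E).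
Proof.
move=> ap; rewrite (_ : (fun x => _) =
    (fun x => \sum_(i < k.+1) ((p (s i))%:E * (bary s i x)%:E)%E)); last first.
  apply/funext => x; rewrite (affine_baryE indep x ap) -sumEFin.
  by apply: eq_bigr => i _; rewrite EFinM.
apply: integrable_sum => [|i _]; first exact: measurable_simplex.
apply: integrableZl; [exact: measurable_simplex|exact: integrable_bary].
Qed.

(** The barycenter rule is exact because [p] is the combination of the coordinates with weights
    [p (s i)], and all coordinates have the same integral. *)
Lemma integral_affine (p : 'rV[R]_k -> R) : affine_form p ->
  (\int[mu]_(x in simplex) (p x)%:E = (volume * p (barycenter s))%:E)%E.
Proof.
move=> ap.
have msx := measurable_simplex.
rewrite (eq_integral (fun x => \sum_(i < k.+1) ((p (s i))%:E * (bary s i x)%:E)%E)) => [|x _].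
  rewrite integral_sum//; last first.
    by move=> i; apply: integrableZl => //; exact: integrable_bary.
  rewrite affine_barycenter// mulrCA !mulr_sumr -sumEFin; apply: eq_bigr => i _.
  rewrite integralZl//; last exact: integrable_bary.
  by rewrite integral_bary -EFinM; congr EFin; ring.
by rewrite (affine_baryE indep x ap) -sumEFin; apply: eq_bigr => i _; rewrite EFinM.
Qed.

End simplex_measure.

(** * Two simplices with a common face *)

Section face_map.
Context {R : realType} {k : nat}.
Implicit Types s : 'I_k.+1 -> 'rV[R]_k.

Definition face s i : set 'rV[R]_k := range (fun j => s (lift i j)).

Lemma face_vertex s i x : face s i x -> exists2 j, j != i & x = s j.
Proof. by move=> [j _ <-]; exists (lift i j) => //; rewrite eq_sym neq_lift. Qed.

Lemma vertex_face s i j : j != i -> face s i (s j).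
Proof. by rewrite eq_sym => /unlift_some[l -> _]; exists l. Qed.

(* The affine map fixing the face opposite to [s i] and sending [s i] to [v]. *)
Definition face_map s i v (x : 'rV[R]_k) : 'rV[R]_k :=
  x + bary s i x *: (v - s i).

Lemma affine_face_map s i v (p : 'rV[R]_k -> R) :
  affine_form p -> affine_form (p \o face_map s i v).
Proof.
move=> [a [g pE]]; have [b [h bE]] := affine_bary s i.
exists (a + b * dotv g (v - s i)), (g + dotv g (v - s i) *: h) => x.
by rewrite /= /face_map pE dotvDr dotvZr bE dotvDl dotvZl; ring.
Qed.

Variables (s s' : 'I_k.+1 -> 'rV[R]_k) (i i' : 'I_k.+1).
Hypothesis indep : affinely_independent s.
Hypothesis indep' : affinely_independent s'.
Hypothesis ss' : face s i = face s' i'.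

Let f := face_map s i (s' i').

Let f_apex : f (s i) = s' i'.
Proof. by rewrite /f /face_map bary_vertex// eqxx scale1r addrC subrK. Qed.

Let f_face x : face s i x -> f x = x.
Proof.
move=> /face_vertex[j ji ->].
by rewrite /f /face_map bary_vertex// eq_sym (negbTE ji) scale0r addr0.
Qed.

Lemma face_map_simplex x :
  convex_hull (range s) x -> convex_hull (range s') (f x).
Proof.
rewrite !simplex_baryE// => x0 j.
have ap : affine_form (bary s' j \o f) by apply: affine_face_map; exact: affine_bary.
rewrite [bary _ _ _](affine_baryE indep x ap); apply: sumr_ge0 => l _.
apply: mulr_ge0; last exact: x0.
have [->|li] := eqVneq l i; first by rewrite /= f_apex bary_vertex.
have sl := vertex_face s li; rewrite /= f_face//.
by move: sl; rewrite ss' => /face_vertex[m _ ->]; rewrite bary_vertex.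
Qed.

Lemma bary_face_map x : bary s' i' (f x) = bary s i x.
Proof.
have ap : affine_form (bary s' i' \o f) by apply: affine_face_map; exact: affine_bary.
rewrite [LHS](affine_baryE indep x ap) (bigD1 i)//= f_apex bary_vertex// eqxx mul1r.
rewrite big1 ?addr0// => l li.
have sl := vertex_face s li; rewrite f_face//.
move: sl; rewrite ss' => /face_vertex[m mi ->].
by rewrite bary_vertex// eq_sym (negbTE mi) mul0r.
Qed.

(** Both coordinates are affine and vanish on the common face, so they are proportional; the factor
    is read off at the apex [s' i']. *)
Lemma bary_face_proportional x :
  bary s i x = bary s i (s' i') * bary s' i' x.
Proof.
rewrite (affine_baryE indep' x (affine_bary s i)) (bigD1 i')//= big1 ?addr0//.
move=> l li; have := vertex_face s' li.
rewrite -ss' => /face_vertex[m mi ->].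
by rewrite bary_vertex// eq_sym (negbTE mi) mul0r.
Qed.

Lemma bary_apex_neq0 : bary s i (s' i') != 0.
Proof.
apply: contraTneq isT => c0; have := bary_face_proportional (s i).
by rewrite c0 mul0r bary_vertex// eqxx => /eqP; rewrite oner_eq0.
Qed.

Lemma bary_grad_face : bary_grad s i = bary s i (s' i') *: bary_grad s' i'.
Proof.
apply/eqP; rewrite -subr_eq0 -dotv_eq0; apply/eqP; set v := _ - _.
have E0 : bary_const s i = bary s i (s' i') * bary_const s' i'.
  exact: bary_face_proportional.
have := bary_face_proportional v; rewrite (baryE s) (baryE s') mulrDr E0 => /addrI E.
by rewrite {1}/v dotvBl dotvZl E subrr.
Qed.

End face_map.

Section face_volume.
Context {R : realType} {k : nat}.
Variables (s s' : 'I_k.+1 -> 'rV[R]_k) (i i' : 'I_k.+1).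
Hypothesis indep : affinely_independent s.
Hypothesis indep' : affinely_independent s'.
Hypothesis ss' : face s i = face s' i'.

Lemma face_mapK : cancel (face_map s i (s' i')) (face_map s' i' (s i)).
Proof.
move=> x; rewrite {1}/face_map (bary_face_map indep indep' ss') /face_map.
by rewrite -addrA -scalerDr addrA subrK subrr scaler0 addr0.
Qed.

(** [face_map] carries one simplex onto the other, and its determinant [bary s i (s' i')] is the
    signed ratio of the heights over the common face. *)
Lemma volume_face : volume s' = `|bary s i (s' i')| * volume s.
Proof.
have c0 := bary_apex_neq0 indep indep' ss'.
have cE : 1 + dotv (bary_grad s i) (s' i' - s i) = bary s i (s' i').
  by have := bary_vertex indep i i; rewrite eqxx mulr1n !baryE dotvBr => E; lra.
apply: EFin_inj; rewrite EFinM -!volumeE//.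
have mS := measurable_simplex indep'.
rewrite -(@lebesgue_rV_rank_one _ _ (bary_grad s i) (s' i' - s i)
  (bary_const s i) _ _ mS) cE//.
congr (_ * lebesgue_rV k _)%E; apply/seteqP; split => x /=.
  rewrite -baryE => /(face_map_simplex indep' indep (esym ss')).
  by rewrite face_mapK.
by rewrite -baryE => /(face_map_simplex indep indep' ss').
Qed.

(* Both sides are the surface measure of the common face divided by [k]. *)
Lemma volume_grad_face :
  volume s * enorm (bary_grad s i) = volume s' * enorm (bary_grad s' i').
Proof.
rewrite volume_face (bary_grad_face indep indep' ss') /enorm dotvZl dotvZr mulrA.
rewrite sqrtrM; last by rewrite -expr2 sqr_ge0.
by rewrite -expr2 sqrtr_sqr mulrCA mulrA.
Qed.

End face_volume.

(** * The divergence theorem on a simplex *)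

Section affine_derivative.
Context {R : realType} {n : nat}.

Lemma dotv_delta (x : 'rV[R]_n.+1) j : dotv x (delta_mx 0 j) = x 0 j.
Proof.
rewrite /dotv (bigD1 j)//= big1 => [|l lj]; rewrite mxE eqxx ?eqxx/=.
  by rewrite mulr1 addr0.
by rewrite (negbTE lj) mulr0.
Qed.

Lemma derive_affine (p : 'rV[R]_n.+1 -> R) (a : R) (g v x : 'rV[R]_n.+1) :
  (forall y, p y = a + dotv g y) -> 'D_v p x = dotv g v.
Proof.
move=> pE; rewrite /derive; apply: cvg_lim => //.
apply: cvg_near_cst; apply: filterS (nbhs_dnbhs_neq (0 : R)) => h h0 /=.
rewrite /= !pE dotvDr dotvZr.
rewrite (_ : _ - _ = h * dotv g v); last ring.
by rewrite /GRing.scale/= mulKf.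
Qed.

Lemma gradient_affine (p : 'rV[R]_n.+1 -> R) (a : R) (g x : 'rV[R]_n.+1) :
  (forall y, p y = a + dotv g y) -> gradient p x = g.
Proof.
move=> pE; by apply/rowP => j; rewrite mxE (derive_affine _ _ pE) dotv_delta.
Qed.

End affine_derivative.

Section simplex_divergence.
Context {R : realType} {n : nat} (s : 'I_n.+2 -> 'rV[R]_n.+1).
Hypothesis indep : affinely_independent s.
Local Notation g := (bary_grad s).

Lemma gradient_bary (u : 'rV[R]_n.+1 -> R) x v : affine_form u ->
  dotv (gradient u x) v = \sum_i u (s i) * dotv (g i) v.
Proof.
move=> au; have [a [h uE]] := au; rewrite (gradient_affine x uE).
have := affine_baryE indep v au; have := affine_baryE indep 0 au.
under [X in _ -> _ = X -> _]eq_bigr do rewrite baryE mulrDr.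
by rewrite big_split/= => <-; rewrite !uE dotv0r addr0 => /addrI.
Qed.

Lemma divergence_bary (z : 'rV[R]_n.+1 -> 'rV[R]_n.+1) x :
  (forall j, affine_form (fun y => z y 0 j)) ->
  divergence z x = \sum_i dotv (g i) (z (s i)).
Proof.
move=> az; rewrite /dotv exchange_big/=; apply: eq_bigr => j _.
have [a [h zE]] := az j; rewrite (derive_affine _ _ zE).
under [RHS]eq_bigr do rewrite zE mulrDr.
rewrite big_split/= -mulr_suml.
have -> : \sum_i g i 0 j = 0 by rewrite -summxE sum_bary_grad// mxE.
rewrite mul0r add0r [in LHS](bary_grad_basis indep (delta_mx 0 j)) dotv_sumr.
by apply: eq_bigr => i _; rewrite dotvZr dotv_delta.
Qed.

(* Divergence theorem for the field [u z], divided by the volume: up to the sign,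
   [n.+1 * volume s * g i] is the outward normal of the face opposite to [s i]
   times the measure of that face. *)
Lemma simplex_green (u : 'rV[R]_n.+1 -> R) (z : 'rV[R]_n.+1 -> 'rV[R]_n.+1) x y :
  affine_form u -> (forall j, affine_form (fun y => z y 0 j)) ->
  (forall i, exists c, forall y, face s i y -> dotv (g i) (z y) = c) ->
  let b i := barycenter (fun j => s (lift i j)) in
  dotv (gradient u x) (z (barycenter s)) + divergence z y * u (barycenter s) =
  - (n.+1%:R * \sum_i dotv (g i) (z (b i)) * u (b i)).
Proof.
move=> au az cz b.
have agz i : affine_form (fun y => dotv (g i) (z y)).
  by apply: affine_sum => j; apply: affine_scale; exact: az.
pose c i := dotv (g i) (z (b i)).
(* The flux through face i is constant on that face, so its value at the barycenter is also its
   value at each vertex other than [s i]. *)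
have cE i j : j != i -> dotv (g i) (z (s j)) = c i.
  move=> ji; have [d dE] := cz i; rewrite /c [RHS](affine_barycenter _ (agz i)).
  rewrite dE; last exact: vertex_face.
  rewrite (eq_bigr (fun=> d)) => [|l _]; last by rewrite dE//; exists l.
  rewrite sumr_const card_ord -[d *+ _]mulr_natl mulKf//.
pose C := \sum_i c i.
(* At the remaining vertex the flux follows from the others, since the gradients sum to zero. *)
have dE j : dotv (g j) (z (s j)) = c j - C.
  have : \sum_i dotv (g i) (z (s j)) = 0 by rewrite -dotv_suml sum_bary_grad// dotv0l.
  rewrite (bigD1 j)//=.
  rewrite (eq_bigr c) => [|i ij]; last by apply: cE; rewrite eq_sym.
  by move=> /eqP; rewrite addr_eq0 => /eqP ->; rewrite /C [in RHS](bigD1 j)//=; ring.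
have n1 : n.+1%:R != 0 :> R by rewrite pnatr_eq0.
have n2 : n.+2%:R != 0 :> R by rewrite pnatr_eq0.
(* Average over the n+2 vertices: n+1 of them contribute [c i] and [s i] contributes [c i - C]. *)
have gz i : dotv (g i) (z (barycenter s)) = c i - n.+2%:R^-1 * C.
  rewrite [LHS](affine_barycenter _ (agz i)) (bigD1 i)//= dE.
  rewrite (eq_bigr (fun=> c i)) => [|j ji]; last by rewrite cE.
  rewrite sumr_const cardC1 card_ord/= -[c i *+ _]mulr_natl.
  by rewrite -[n.+2%:R]natr1 in n2 *; field.
pose U := \sum_i u (s i).
have ub i : u (b i) = n.+1%:R^-1 * (U - u (s i)).
  rewrite affine_barycenter//; congr (_ * _).
  rewrite /U (bigD1_ord i)//=; ring.
(* Both sides of the identity equal [\sum_i c i * u (s i) - C * U]. *)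
rewrite gradient_bary// divergence_bary//.
under eq_bigr do rewrite gz mulrBr.
under [X in _ + X * _]eq_bigr do rewrite dE.
under [X in - (_ * X)]eq_bigr => i _ do
  rewrite -/(c i) ub mulrCA mulrBr [c i * u _]mulrC.
rewrite -mulr_sumr mulVKf// !sumrB -!mulr_suml -/C -/U affine_barycenter// -/U.
rewrite sumr_const card_ord -[C *+ _]mulr_natl.
by field.
Qed.

End simplex_divergence.

(** * Reference simplex and surface integrals of affine functions *)

Section reference_simplex.
Context {R : realType} {k : nat}.

Definition ref_vtx (i : 'I_k.+1) : 'rV[R]_k :=
  if unlift ord0 i is Some j then delta_mx 0 j else 0.

Lemma ref_vtx0 : ref_vtx ord0 = 0.
Proof. by rewrite /ref_vtx unlift_none. Qed.

Lemma ref_vtxS j : ref_vtx (lift ord0 j) = delta_mx 0 j.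
Proof. by rewrite /ref_vtx liftK. Qed.

Lemma ref_vtx_comb (l : 'I_k.+1 -> R) :
  \sum_i l i *: ref_vtx i = \row_j l (lift ord0 j).
Proof.
rewrite big_ord_recl ref_vtx0 scaler0 add0r [RHS]row_sum_delta.
by apply: eq_bigr => j _; rewrite ref_vtxS mxE.
Qed.

Lemma ref_vtx_indep : affinely_independent ref_vtx.
Proof.
move=> l; rewrite ref_vtx_comb big_ord_recl => l0 /rowP lE.
have lS j : l (lift ord0 j) = 0 by have := lE j; rewrite !mxE.
move=> i; have [j ->|->] := unliftP ord0 i; first exact: lS.
by rewrite big1 ?addr0 in l0.
Qed.

Lemma ref_simplexE : ref_simplex = convex_hull (range ref_vtx) :> set 'rV[R]_k.
Proof.
have ir := ref_vtx_indep; rewrite (simplex_baryE ir).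
have bE x : x = \row_j bary ref_vtx (lift ord0 j) x.
  by rewrite -ref_vtx_comb bary_comb.
have bS j x : bary ref_vtx (lift ord0 j) x = x 0 j by rewrite {2}[x]bE mxE.
have b0 x : bary ref_vtx ord0 x = 1 - \sum_j x 0 j.
  rewrite -(sum_bary ir x) big_ord_recl.
  by under eq_bigr do rewrite bS; rewrite addrK.
apply/seteqP; split => x /=; rewrite /ref_simplex/=.
  move=> [x0 x1] i; have [j ->|->] := unliftP ord0 i; first by rewrite bS.
  by rewrite b0 subr_ge0.
by move=> xb; split => [j|]; [rewrite -bS|rewrite -subr_ge0 -b0].
Qed.

End reference_simplex.

Section surface_integral.
Context {R : realType} {n : nat}.

Lemma affine_mulmx k (p : 'rV[R]_n -> R) (a : 'rV[R]_n) (E : 'M[R]_(k, n)) :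
  affine_form p -> affine_form (fun t => p (a + t *m E)).
Proof.
move=> [c [g pE]]; exists (c + dotv g a), (g *m E^T) => t.
rewrite pE dotvDr addrA; congr (_ + _).
by rewrite dotvC [RHS]dotvC !dotv_mx trmx_mul trmxK mulmxA.
Qed.

(** The parametrization is affine, so the barycenter rule on the reference simplex applies, and it
    sends the reference barycenter to that of [s]. *)
Lemma simplex_integral_affine k (s : 'I_k.+1 -> 'rV[R]_n) (p : 'rV[R]_n -> R) :
  affine_form p ->
  simplex_integral s p =
  Num.sqrt (\det (edge_mx s *m (edge_mx s)^T)) * volume (@ref_vtx R k) * p (barycenter s).
Proof.
move=> ap; rewrite /simplex_integral -mulrA; congr (_ * _).
have ap' := affine_mulmx (s ord0) (edge_mx s) ap.
rewrite /Rintegral ref_simplexE (integral_affine ref_vtx_indep ap')/=.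
suff -> : p (s ord0 + barycenter ref_vtx *m edge_mx s) = p (barycenter s) by [].
rewrite (affine_barycenter _ ap') (affine_barycenter _ ap); congr (_ * _).
apply: eq_bigr => i _; congr p.
have [j ->|->] := unliftP ord0 i; last by rewrite ref_vtx0 mul0mx addr0.
by rewrite ref_vtxS -rowE rowK addrC subrK.
Qed.

End surface_integral.

Section face_gram.
Context {R : realType} {n : nat} (s : 'I_n.+2 -> 'rV[R]_n.+1).
Hypothesis indep : affinely_independent s.

(** Adding the normal direction [nu] to the edges gives a square matrix [B] whose squared
    determinant is [dotv nu nu] times the Gram determinant; it remains to see that [B] is
    invertible. *)
Lemma face_gram_gt0 (i : 'I_n.+2) :
  0 < \det (edge_mx (fun j : 'I_n.+1 => s (lift i j)) *m
            (edge_mx (fun j : 'I_n.+1 => s (lift i j)))^T).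
Proof.
set E := edge_mx _; pose nu := bary_grad s i.
have nu0 : nu != 0 by exact: bary_grad_neq0.
(* The gradients of the other coordinates are biorthogonal to the edges, so multiplying [B] by [nu]
   stacked on [G], transposed, gives a triangular matrix with nonzero determinant. *)
pose G : 'M[R]_(n, n.+1) := \matrix_j bary_grad s (lift i (lift ord0 j)).
have Ei (j : 'I_n) l : (E *m (bary_grad s l)^T) j 0 =
    (l == lift i (lift ord0 j))%:R - (l == lift i ord0)%:R.
  rewrite -(bary_grad_diff indep) dotvC dotv_mx.
  rewrite (_ : (E *m _) j 0 = row j (E *m (bary_grad s l)^T) 0 0); last by rewrite [RHS]mxE.
  by rewrite row_mul rowK.
have Enu : E *m nu^T = 0.
  apply/colP => j; rewrite Ei mxE.
  by rewrite !(negbTE (neq_lift _ _)) subrr.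
have EG : E *m G^T = 1%:M.
  apply/matrixP => j l.
  have -> : (E *m G^T) j l = (E *m (bary_grad s (lift i (lift ord0 l)))^T) j 0.
    by rewrite !mxE; apply: eq_bigr => m _; rewrite !mxE.
  rewrite Ei !(inj_eq lift_inj) eq_sym mxE.
  by rewrite eq_sym [lift _ _ == _]eq_sym (negbTE (neq_lift _ _)) subr0 eq_sym.
pose B : 'M[R]_(1 + n) := col_mx nu E.
have nunu : nu *m nu^T = (dotv nu nu)%:M by rewrite [LHS]mx11_scalar dotv_mx.
have BB : B *m B^T = block_mx (dotv nu nu)%:M 0 0 (E *m E^T).
  rewrite /B tr_col_mx mul_col_row Enu nunu; congr block_mx.
  by rewrite -[LHS]trmxK trmx_mul trmxK Enu trmx0.
have BC : B *m (col_mx nu G)^T = block_mx (dotv nu nu)%:M (nu *m G^T) 0 1%:M.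
  by rewrite /B tr_col_mx mul_col_row Enu EG nunu.
have B0 : \det B != 0.
  have := congr1 determinant BC; rewrite det_mulmx det_ublock det1 mulr1 det_scalar1.
  by apply: contra_eq_neq => ->; rewrite mul0r eq_sym dotv_eq0.
have := congr1 determinant BB; rewrite det_mulmx det_tr det_ublock det_scalar1.
move=> H; rewrite -(pmulr_rgt0 _ (_ : 0 < dotv nu nu)) ?dotv_gt0// -H.
by rewrite -expr2 exprn_even_gt0.
Qed.

(** Turns the mean-value condition on Crouzeix-Raviart jumps into a value at the barycenter of the
    side. *)
Lemma face_integral_eq0 (i : 'I_n.+2) (p : 'rV[R]_n.+1 -> R) : affine_form p ->
  simplex_integral (fun j : 'I_n.+1 => s (lift i j)) p = 0 ->
  p (barycenter (fun j : 'I_n.+1 => s (lift i j))) = 0.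
Proof.
move=> ap; rewrite simplex_integral_affine// => /eqP; rewrite !mulf_eq0.
rewrite gt_eqF ?sqrtr_gt0 ?face_gram_gt0//= gt_eqF/=.
  by move=> /eqP.
exact/volume_gt0/ref_vtx_indep.
Qed.

End face_gram.

(** * Sides of a triangulation and discrete integration by parts *)

Section preliminaries.
Context {R : realType} {n : nat}.

Lemma subset_convex_hull (A : set 'rV[R]_n) : A `<=` convex_hull A.
Proof.
move=> x Ax; exists 1%N, (fun=> x), (fun=> 1); split => //.
  by rewrite big_ord1.
by rewrite big_ord1 scale1r.
Qed.

Lemma convex_hullS (A B : set 'rV[R]_n) : A `<=` B -> convex_hull A `<=` convex_hull B.
Proof.
by move=> AB x [k [a [l [Aa l0 l1 ->]]]]; exists k, a, l; split => // i; exact/AB/Aa.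
Qed.

Lemma barycenter_hull k (a : 'I_k.+1 -> 'rV[R]_n) :
  convex_hull (range a) (barycenter a).
Proof.
exists k.+1, a, (fun=> k.+1%:R^-1); split => //.
  by rewrite sumr_const card_ord -[LHS]mulr_natl divff// pnatr_eq0.
by rewrite /barycenter scaler_sumr.
Qed.

(** Two elements may enumerate the vertices of a common side in different orders. *)
Lemma barycenter_range k (a b : 'I_k -> 'rV[R]_n) : injective a ->
  range a = range b -> barycenter a = barycenter b.
Proof.
move=> ia ab; have /choice[f fE] j : exists l, a j = b l.
  have : range b (a j) by rewrite -ab; exists j.
  by move=> [l _ <-]; exists l.
have fi : injective f by move=> j l jl; apply: ia; rewrite !fE jl.
rewrite /barycenter [in RHS](reindex_inj fi); congr (_ *: _).
by apply: eq_bigr => j _; exact: fE.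
Qed.

Lemma near_line (x v : 'rV[R]_n.+1) (A : set 'rV[R]_n.+1) : nbhs x A ->
  \forall t \near (0 : R)^'+, A (x + t *: v).
Proof.
move=> xA.
have H : (fun t : R => x + t *: v) t @[t --> (0 : R)] --> x + 0 *: v.
  apply: (@cvgD _ _ _ (nbhs (0 : R)) _ (fun=> x)); first exact: cvg_cst.
  by apply: (@cvgZ _ _ _ (nbhs (0 : R)) _ id (fun=> v)); [exact: cvg_id|exact: cvg_cst].
rewrite scale0r addr0 in H.
exact: (cvg_at_right_filter H) xA.
Qed.

End preliminaries.

(* Spread each [F p] evenly over the other members of its class; exchanging the
   two summation indices then changes the sign of the sum. *)
Lemma sum_paired_eq0 (R : realType) (I : finType) (e : rel I) (F : I -> R) :
  reflexive e -> symmetric e -> transitive e ->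
  (forall p q, p != q -> e p q -> F p + F q = 0) ->
  (forall p, (forall q, p != q -> ~~ e p q) -> F p = 0) ->
  \sum_p F p = 0.
Proof.
move=> er es et F2 F1.
pose m p := #|[pred q | (p != q) && e p q]|.
have mE p q : p != q -> e p q -> m p = m q.
  have mD r : #|e r| = (m r).+1.
    rewrite (cardD1 r) unfold_in er add1n; congr S; apply: eq_card => l.
    by rewrite !inE eq_sym.
  move=> _ epq; apply: eq_add_S; rewrite -!mD; apply: eq_card => l.
  by rewrite !unfold_in; apply/idP/idP; apply: et; rewrite // es.
(* For a class with a single member the sum is empty and [F p] vanishes by hypothesis. *)
have FE p : F p = \sum_(q | (p != q) && e p q) F p / (m p)%:R.
  rewrite sumr_const -/(m p); have [m0|m0] := eqVneq (m p) 0%N.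
    rewrite m0 F1// => q pq; apply/negP => epq.
    by move/eqP: m0; rewrite /m -leqn0 leqNgt => /negP; apply; apply/card_gt0P; exists q; rewrite inE pq.
  by rewrite -[RHS]mulr_natr divfK// pnatr_eq0.
have S : \sum_p F p = \sum_p \sum_(q | (p != q) && e p q) F p / (m p)%:R.
  by apply: eq_bigr => p _; exact: FE.
have S' : \sum_p F p = \sum_p \sum_(q | (p != q) && e p q) F q / (m p)%:R.
  rewrite S (exchange_big_dep xpredT)//=; apply: eq_bigr => q _.
  apply: eq_big => p; first by rewrite eq_sym es.
  by move=> /andP[pq epq]; rewrite (mE p q).
suff : \sum_p F p + \sum_p F p = 0 by move=> ?; lra.
rewrite {1}S S' -big_split big1// => p _; rewrite -big_split big1// => q /andP[pq epq].
by rewrite /= -mulrDl F2// mul0r.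
Qed.

Section triangulations.
Context {R : realType} {n : nat} (M : mesh R n) (Om : set 'rV[R]_n.+1).
Hypothesis tri : triangulation M Om.
Local Notation s := (vtx M).

Lemma triangulation_indep T : affinely_independent (s T).
Proof. by case: tri. Qed.
Local Notation ind := (@triangulation_indep).

Lemma side_sub_cell T i : side (M := M) T i `<=` cell T.
Proof. by apply: convex_hullS => _ [j _ <-]; exists (lift i j). Qed.

(** A side determines its vertices, as these are the extreme points of its hull. *)
Lemma side_face T i T' i' : side (M := M) T i = side (M := M) T' i' ->
  face (s T) i = face (s T') i'.
Proof.
have H T1 i1 T2 i2 : side (M := M) T1 i1 = side T2 i2 ->
    face (s T1) i1 `<=` face (s T2) i2.
  move=> E x fx; have [j ji xj] := face_vertex fx; rewrite xj.
  apply: (vertex_extreme (ind T1) (A := face (s T2) i2)).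
    apply: subset_trans (@side_sub_cell T1 i1); rewrite E; exact: subset_convex_hull.
  have : side T1 i1 (s T1 j) by apply: subset_convex_hull; exact: vertex_face.
  by rewrite E.
by move=> E; apply/seteqP; split; exact: H.
Qed.

Lemma side_inj T : injective (side (M := M) T).
Proof.
move=> i i' /side_face E; have [//|ii'] := eqVneq i i'.
have : face (s T) i (s T i') by apply: vertex_face; rewrite eq_sym.
by rewrite E => /face_vertex[j ji /(vertex_inj (ind T)) ij]; rewrite -ij eqxx in ji.
Qed.

Lemma side_bary0 T i x : side (M := M) T i x -> bary (s T) i x = 0.
Proof.
move=> sx; apply/eqP; apply: contraT => bi.
have fT : face (s T) i `<=` range (s T) by move=> y /face_vertex[j _ ->]; exists j.
have /face_vertex[j ji /(vertex_inj (ind T)) ij] := convex_hull_face (ind T) fT sx bi.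
by rewrite ij eqxx in ji.
Qed.

Lemma side_barycenter T i T' i' : side (M := M) T i = side (M := M) T' i' ->
  barycenter (side_vtx (M := M) T i) = barycenter (side_vtx (M := M) T' i').
Proof.
move=> /side_face E; apply: barycenter_range => //.
by move=> j l /(vertex_inj (ind T))/lift_inj.
Qed.

Lemma cell_sub_closure T : cell (M := M) T `<=` closure Om.
Proof. by move=> x Tx; case: tri => _ _ _ ->; exists T. Qed.

(** Stepping across the side, away from the opposite vertex, stays in [Om] and so enters another
    cell; conformity then makes the whole side common to both. *)
Lemma shared_side T i x : open Om -> side (M := M) T i x -> ~ bd Om x ->
  exists T' i', interior_side (M := M) T i T' i'.
Proof.
move=> oOm sx nbd.
have Tx : cell T x by exact: (side_sub_cell sx).
have Omx : Om x.
  apply: interior_subset; apply: contrapT => nOm; apply: nbd; split => //.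
  exact: cell_sub_closure Tx.
pose b := barycenter (side_vtx (M := M) T i).
have sb : side (M := M) T i b by exact: barycenter_hull.
have bb j : j != i -> 0 < bary (s T) j b.
  rewrite eq_sym => /unlift_some[l -> _].
  rewrite affine_barycenter; last exact: affine_bary.
  rewrite mulr_gt0 ?invr_gt0// (bigD1 l)//= ltr_pwDl//.
    by rewrite bary_vertex ?eqxx//; exact: ind.
  by apply: sumr_ge0 => m _; rewrite bary_vertex ?ler0n//; exact: ind.
(* Moving from [x] slightly towards the barycenter of the side reaches its relative interior without
   leaving the open set [Om]. *)
have [y [Omy y0 yi]] : exists y, [/\ Om y, forall j, j != i -> 0 < bary (s T) j y
    & bary (s T) i y = 0].
  have Omt : \forall t \near (0 : R)^'+, Om (x + t *: (b - x)).
    by apply: near_line; exact: open_nbhs_nbhs.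
  have [t [Omt' [t0 t1]]] : exists t : R, Om (x + t *: (b - x)) /\ 0 < t /\ t < 1.
    near (0 : R)^'+ => t; exists t; split; first by near: t.
    by split; near: t; [exact: nbhs_right_gt|exact: nbhs_right_lt].
  exists (x + t *: (b - x)).
  have E j : bary (s T) j (x + t *: (b - x)) =
      (1 - t) * bary (s T) j x + t * bary (s T) j b.
    by rewrite !baryE dotvDr dotvZr dotvBr; ring.
  split => // [j ji|]; rewrite E.
    rewrite ltr_wpDl ?mulr_gt0 ?bb// mulr_ge0//; first by rewrite subr_ge0 ltW.
    by move: Tx; rewrite /cell /vertices simplex_baryE; [exact|exact: ind].
  by rewrite !(side_bary0 sx) !(side_bary0 sb) !mulr0 addr0.
(* The direction [w] leaves [T] through the side: the i-th coordinate decreases along it at unit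
   rate. *)
pose w := y - s T i.
have Omw : \forall t \near (0 : R)^'+, Om (y + t *: w).
  by apply: near_line; exact: open_nbhs_nbhs.
(* Pigeonhole over the finitely many cells: one of them meets the ray for arbitrarily small [t]. *)
have [T' T'w] : exists T' : elt M, ~ \forall t \near (0 : R)^'+, ~ cell T' (y + t *: w).
  apply: contrapT => /forallNP H.
  have H' : \forall t \near (0 : R)^'+, forall T' : elt M, ~ cell T' (y + t *: w).
    apply: (@filter_forall _ _ (fun T' t => ~ cell T' (y + t *: w)) (0 : R)^'+) => T'.
    apply: contrapT => nT'; apply: (H T').
    exact: nT'.
  have [t [Omt ncell]] : exists t, Om (y + t *: w) /\ forall T' : elt M, ~ cell T' (y + t *: w).
    near (0 : R)^'+ => t; exists t; split; near: t.
      exact: Omw.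
    exact: H'.
  have : closure Om (y + t *: w) by exact: subset_closure.
  by case: tri => _ _ _ -> [T' _ T'y]; exact: ncell T'y.
have TT' : T <> T'.
  move=> E; apply: T'w; rewrite -E; near=> t => Ty.
  have t0 : 0 < t by near: t; exact: nbhs_right_gt.
  move: Ty; rewrite /cell /vertices simplex_baryE; last exact: ind.
  move=> /(_ i); rewrite baryD dotvZr yi add0r /w.
  rewrite (_ : dotv _ _ = -1) ?mulrN1 ?oppr_ge0; first by rewrite leNgt t0.
  have := yi; have := bary_vertex (ind T) i i; rewrite eqxx mulr1n !baryE dotvBr => ? ?.
  by lra.
(* Cells are closed: a negative coordinate at [y] would stay negative along the ray near [y]. *)
have T'y : cell T' y.
  rewrite /cell /vertices simplex_baryE; last exact: ind.
  move=> j; rewrite leNgt; apply/negP => yj; apply: T'w.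
  have : nbhs y [set z | bary (s T') j z < 0].
    have /cvgr_lt := continuous_affine_form (affine_bary (s T') j) (x := y).
    by apply.
  move=> /(near_line w); apply: filterS => t /= tj.
  rewrite /cell /vertices simplex_baryE; last exact: ind.
  by move=> /(_ j); rewrite leNgt tj.
(* By conformity [y] is in the hull of the shared vertices, and its coordinates other than the i-th
   are positive, so every vertex of the side is shared. *)
have sT' j : j != i -> range (s T') (s T j).
  move=> ji; have [_ _ TTE _] := tri.
  have : (cell T `&` cell T') y.
    split => //; rewrite /cell /vertices simplex_baryE; last exact: ind.
    by move=> l; have [->|/y0/ltW//] := eqVneq l i; rewrite yi.
  rewrite TTE => /(convex_hull_face (ind T)).
  by move=> /(_ j) H; have [|//] := H _ (lt0r_neq0 (y0 _ ji)) => z [].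
have /choice[f fE] (j : 'I_n.+1) : exists l, s T (lift i j) = s T' l.
  have : range (s T') (s T (lift i j)) by apply: sT'; rewrite eq_sym neq_lift.
  by move=> [l _ <-]; exists l.
have fi : injective f.
  by move=> j l jl; apply: (@lift_inj _ i); apply: (vertex_inj (ind T)); rewrite !fE jl.
(* The n+1 shared vertices occupy all but one of the n+2 indices of [T']; the missing one is
   [i']. *)
have [i' i'f] : exists i', i' \notin [set f j | j : 'I_n.+1]%SET.
  apply/existsP; apply: contraT; rewrite negb_exists => /forallP H.
  have : #|[set: 'I_n.+2]%SET| = #|[set f j | j : 'I_n.+1]%SET|.
    by apply: eq_card => l; have := H l; rewrite negbK inE => ->.
  by rewrite card_imset// cardsT !card_ord => /eqP; rewrite gtn_eqF.
exists T', i'; split => //.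
have imE : [set f j | j : 'I_n.+1]%SET = [set~ i']%SET.
  apply/eqP; rewrite eqEcard; apply/andP; split.
    by apply/fintype.subsetP => l lf; rewrite !inE; apply: contraNneq i'f => <-.
  by rewrite card_imset// cardsC1 !card_ord.
congr convex_hull; apply/seteqP; split => z [j _ <-].
  rewrite /side_vtx fE; apply: (@vertex_face _ _ (s T') i').
  have : f j \in [set~ i']%SET by rewrite -imE imset_f.
  by rewrite !inE.
have : lift i' j \in [set f j | j : 'I_n.+1]%SET.
  by rewrite imE !inE eq_sym neq_lift.
by move=> /imsetP[l _ E]; exists l => //; rewrite /side_vtx fE -E.
Unshelve. all: by end_near.
Qed.

End triangulations.

Section discrete_green.
Context {R : realType} {n : nat} (M : mesh R n) (Om GD GN : set 'rV[R]_n.+1).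
Hypothesis tri : triangulation M Om.
Hypothesis oOm : open Om.
Hypothesis part : boundary_partition Om GD GN.
Local Notation s := (vtx M).
Local Notation ind := (triangulation_indep tri).
Local Notation g T := (bary_grad (s T)).
Local Notation bs T i := (barycenter (side_vtx (M := M) T i)).

Lemma enorm_gt0 (x : 'rV[R]_n.+1) : (0 < enorm x) = (x != 0).
Proof. by rewrite /enorm sqrtr_gt0 dotv_gt0. Qed.

Lemma enormZ a (x : 'rV[R]_n.+1) : enorm (a *: x) = `|a| * enorm x.
Proof.
rewrite /enorm dotvZl dotvZr mulrA sqrtrM; last by rewrite -expr2 sqr_ge0.
by rewrite -expr2 sqrtr_sqr.
Qed.

(** Both vectors are orthogonal to the side, hence collinear; the sign comes from outwardness and
    the factor from [enorm nu = 1]. *)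
Lemma outward_normalE T i nu : is_outward_normal (M := M) T i nu ->
  bary_grad (s T) i = - enorm (bary_grad (s T) i) *: nu.
Proof.
move=> [nu1 nuS nuT]; have is_ := ind (T := T).
pose x0 := s T (lift i 0).
have sx0 : side (M := M) T i x0.
  by apply: subset_convex_hull; exists ord0.
pose t := dotv nu (s T i - x0).
have t0 : t < 0 by exact: nuT.
have nuE : nu = t *: g T i.
  have H v : dotv nu v = t * dotv (g T i) v.
    rewrite [in LHS](bary_grad_basis is_ v).
    have -> : \sum_j dotv (g T j) v *: s T j = \sum_j dotv (g T j) v *: (s T j - x0).
      under [RHS]eq_bigr do rewrite scalerBr.
      by rewrite sumrB -scaler_suml -dotv_suml sum_bary_grad// dotv0l scale0r subr0.
    rewrite dotv_sumr (bigD1 i)//= big1 ?addr0 => [|j ji].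
      by rewrite dotvZr mulrC.
    rewrite dotvZr nuS ?mulr0//; apply: subset_convex_hull.
    exact: (vertex_face (s T) ji).
  apply/eqP; rewrite -subr_eq0 -dotv_eq0; apply/eqP; set v := _ - _.
  by rewrite {1}/v dotvBl dotvZl H subrr.
have : enorm nu = 1 by [].
rewrite nuE enormZ ltr0_norm// scalerA => tg.
by rewrite -[LHS]scale1r -tg; congr (_ *: _); ring.
Qed.

(** [normal] is a choice with default 0, so an outward normal must be exhibited: the normalized
    opposite of the gradient of the i-th coordinate. *)
Lemma outward_normal_normal T i : is_outward_normal (M := M) T i (normal T i).
Proof.
rewrite /normal; case: xgetP => [nu _ //|H]; exfalso.
have is_ := ind (T := T).
have gi0 : 0 < enorm (g T i) by rewrite enorm_gt0; exact: bary_grad_neq0.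
apply: (H (- (enorm (g T i))^-1 *: g T i)); split.
- by rewrite enormZ normrN gtr0_norm ?invr_gt0// mulVf// gt_eqF.
- move=> x y /(side_bary0 tri) xb /(side_bary0 tri) yb; rewrite dotvZl dotvBr.
  by move: xb yb; rewrite !baryE => ? ?; rewrite (_ : _ - _ = 0) ?mulr0//; lra.
- move=> x /(side_bary0 tri); rewrite dotvZl dotvBr => xb.
  have := bary_vertex is_ i i; rewrite eqxx mulr1n.
  move: xb; rewrite !baryE => ? ?.
  by rewrite (_ : _ - _ = 1) ?mulr1 ?oppr_lt0 ?invr_gt0//; lra.
Qed.

Lemma bary_grad_normal T i x :
  dotv (g T i) x = - (enorm (g T i) * dotv (normal T i) x).
Proof.
by rewrite {1}(outward_normalE (outward_normal_normal T i)) dotvZl mulNr.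
Qed.

Lemma discrete_green u z : CR M GD u -> RT M Om GN z ->
  \sum_T volume (s T) *
    (dotv (gradient (u T) 0) (z T (barycenter (s T)))
     + divergence (z T) 0 * u T (barycenter (s T))) = 0.
Proof.
move=> [uL uI uD] [zL zc zI zN]; have [GDN _ _] := part.
pose c T i := dotv (normal T i) (z T (bs T i)).
(* The first two factors give the measure of the side divided by n+1, which explains the prefactor
   [n.+1%:R] below. *)
pose F (p : elt M * 'I_n.+2) : R :=
  volume (s p.1) * enorm (g p.1 p.2) * c p.1 p.2 * u p.1 (bs p.1 p.2).
have sb T i : side (M := M) T i (bs T i) by exact: barycenter_hull.
have E T : volume (s T) * (dotv (gradient (u T) 0) (z T (barycenter (s T)))
     + divergence (z T) 0 * u T (barycenter (s T)))
     = n.+1%:R * \sum_i F (T, i).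
  rewrite (simplex_green (ind (T := T)) _ _ (uL T) (zL T)); last first.
    move=> i; have [d dE] := zc T i; exists (- (enorm (g T i) * d)) => y fy.
    rewrite bary_grad_normal dotvC dE//; exact: subset_convex_hull fy.
  rewrite mulrN mulrCA -mulrN; congr (_ * _).
  rewrite mulr_sumr -sumrN; apply: eq_bigr => i _.
  rewrite bary_grad_normal /F/= /c /side_vtx; ring.
under eq_bigr do rewrite E.
rewrite -mulr_sumr pair_bigA/=; suff -> : \sum_p F (p.1, p.2) = 0 by rewrite mulr0.
rewrite (eq_bigr F) => [|[]//].
(* Two indices are equivalent when they describe the same set, and distinct equivalent ones always
   belong to different elements. *)
pose e (p q : elt M * 'I_n.+2) := `[< side (M := M) p.1 p.2 = side (M := M) q.1 q.2 >].
apply: (@sum_paired_eq0 _ _ e) => [p|p q|q p r|p q|p H].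
- exact/asboolP.
- by apply/asboolP/asboolP => ->.
- by move=> /asboolP pq /asboolP qr; apply/asboolP; rewrite pq.
- case: p q => [T i] [T' i'] pq /asboolP/= TT'.
  have nT : T <> T'.
    move=> E'; move: pq TT'; rewrite -E' => pq /(side_inj tri) ii'.
    by rewrite ii' eqxx in pq.
  have fE := side_face tri TT'; have bE := side_barycenter tri TT'.
  have vE := volume_grad_face (ind (T := T)) (ind (T := T')) fE.
  have uE : u T (bs T i) = u T' (bs T' i').
    have au : affine_form (fun x => u T x - u T' x) by apply: affine_sub; exact: uL.
    have := face_integral_eq0 (ind (T := T)) (i := i) au (uI _ _ _ _ (conj nT TT')).
    by move=> /eqP; rewrite subr_eq0 => /eqP ->; rewrite -bE.
  have cE : c T i + c T' i' = 0.
    by rewrite /c -bE !(dotvC (normal _ _)); apply: zI => //; exact: (conj nT TT').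
  by rewrite /F/= -vE -uE -mulrDl -mulrDr cE mulr0 mul0r.
case: p H => T i H; rewrite /F/=.
have sbd : side (M := M) T i `<=` bd Om.
  move=> x sx; apply: contrapT => nbd.
  have [T' [i' [nT TT']]] := shared_side tri oOm sx nbd.
  have := H (T', i'); rewrite /e/= TT' asboolT// => H'.
  by apply: (notF (H' _)); apply/eqP => -[] /nT.
(* Either [u] vanishes at the barycenter, or the side has a point of [GN], where the flux vanishes;
   being constant, it then vanishes on the whole side. *)
have [sD|/existsNP[x /not_implyP[sx nDx]]] := pselect (side (M := M) T i `<=` GD).
  by rewrite uD// mulr0.
have Nx : GN x by have := sbd _ sx; rewrite -GDN => -[].
have [d dE] := zc T i.
have c0 : c T i = 0.
  by rewrite /c dotvC dE// -(dE x sx) zN.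
by rewrite c0 mulr0 mul0r.
Qed.

End discrete_green.

(** * Integrals of element-wise functions *)

Section null_sets.
Local Open Scope ereal_scope.
Context d (T : measurableType d) (R : realType).
Variables (mu : {measure set T -> \bar R}) (N : set T).
Hypothesis mN : measurable N.
Hypothesis N0 : mu N = 0.
Implicit Types f g : T -> \bar R.

Import HBNNSimple.

(** Only the simple functions below [f] need to be measurable: cutting one off on [N] keeps its
    integral and places it below [g]. *)
Let ge0_le_integral_null f g : (forall x, 0 <= f x) -> (forall x, 0 <= g x) ->
  (forall x, ~ N x -> f x = g x) -> \int[mu]_x f x <= \int[mu]_x g x.
Proof.
move=> f0 g0 fg; rewrite !ge0_integralTE//.
apply: ge_ereal_sup => _ [h hf <-].
pose h' := mul_nnsfun h (indic_nnsfun R (measurableC mN)).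
have h'E x : h' x = (h x * \1_(~` N) x)%R by [].
have -> : sintegral mu h = sintegral mu h'.
  rewrite -!integralT_nnsfun; apply: ge0_ae_eq_integral => //.
  - exact/measurable_EFinP.
  - exact/measurable_EFinP.
  - by move=> x _; rewrite lee_fin.
  - by move=> x _; rewrite lee_fin.
  exists N; split => // x /=; apply: contra_notP => Nx _.
  by congr EFin; apply/esym; rewrite [LHS]h'E indicE in_setC memNset// mulr1.
apply: ereal_sup_ubound; exists h' => // x.
rewrite h'E indicE in_setC; have [Nx|Nx] := pselect (N x).
  by rewrite mem_set// mulr0.
by rewrite memNset// mulr1 -fg.
Qed.

(* [psih] may fail to be measurable on the interfaces between elements, so the
   almost-everywhere comparison lemmas of the library do not apply. *)
Lemma eq_integral_null (D : set T) f g :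
  (forall x, D x -> ~ N x -> f x = g x) ->
  \int[mu]_(x in D) f x = \int[mu]_(x in D) g x.
Proof.
move=> fg; rewrite integral_mkcond [RHS]integral_mkcond.
have fg' x : ~ N x -> (f \_ D) x = (g \_ D) x.
  move=> Nx; rewrite !patchE; case: ifPn => //.
  by rewrite inE => Dx; exact: fg.
rewrite integralE [RHS]integralE; congr (_ - _); apply/eqP; rewrite eq_le;
  apply/andP; split; apply: ge0_le_integral_null => // x Nx;
  by rewrite ?funeposE ?funenegE fg'.
Qed.

End null_sets.

Section mesh_null_set.
Context {R : realType} {n : nat} (M : mesh R n) (Om : set 'rV[R]_n.+1).
Hypothesis tri : triangulation M Om.
Hypothesis poly : polyhedral Om.
Local Notation s := (vtx M).
Local Notation ind := (triangulation_indep tri).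
Local Notation mu := (lebesgue_rV n.+1).

Lemma cell_cap_bary0 T T' x : cell (M := M) T x -> cell (M := M) T' x ->
  (forall i, 0 < bary (s T) i x) -> vertices (M := M) T `<=` vertices (M := M) T'.
Proof.
move=> Tx T'x x0 _ [i _ <-]; have [_ _ TTE _] := tri.
have : (cell T `&` cell T') x by [].
rewrite TTE => /(convex_hull_face (ind (T := T))) H.
by have [|//] := H i _ (lt0r_neq0 (x0 i)) => z [].
Qed.

(** [N] contains the hyperplanes carrying the boundary of [Om] and those extending the sides. Off
    [N], a point of a cell has only positive coordinates there. *)
Lemma mesh_null_set : exists N, [/\ measurable N, mu N = 0%E,
    forall x, Om x -> ~ N x -> exists T : elt M, cell T x,
    forall x (T : elt M), cell T x -> ~ N x ->
      Om x /\ forall i, 0 < bary (s T) i x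
  & forall x (T T' : elt M), cell T x -> cell (M := M) T' x -> ~ N x -> T = T'].
Proof.
have [ps [ps0 bdps]] := poly.
pose H1 := \big[setU/set0]_(p <- ps) hyperplane p.1 p.2.
pose H2 := \big[setU/set0]_(p : elt M * 'I_n.+2)
  hyperplane (bary_grad (s p.1) p.2) (- bary_const (s p.1) p.2).
have nbig (I : Type) (r : seq I) (P : pred I) (F : I -> 'rV[R]_n.+1 * R) :
    (forall i, P i -> (F i).1 != 0) ->
    mu.-negligible (\big[setU/set0]_(i <- r | P i) hyperplane (F i).1 (F i).2).
  move=> F0; elim/big_ind : _ => [|A B nA nB|i Pi].
  - exact: negligible_set0.
  - exact: negligibleU.
  - apply/negligibleP; first exact: measurable_hyperplane.
    by apply: lebesgue_rV_hyperplane; exact: F0.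
have [N [mN N0 HN]] : mu.-negligible (H1 `|` H2).
  apply: negligibleU.
    by rewrite /H1 big_seq; apply: (nbig _ ps _ id).
  apply: (nbig _ _ xpredT (fun p : elt M * 'I_n.+2 =>
    (bary_grad (s p.1) p.2, - bary_const (s p.1) p.2))) => p _ /=.
  by apply: bary_grad_neq0 => //; exact: ind.
have pos x T : cell (M := M) T x -> ~ N x -> forall i, 0 < bary (s T) i x.
  move=> Tx Nx i; rewrite lt_neqAle; apply/andP; split; last first.
    by move: Tx; rewrite /cell /vertices simplex_baryE; [exact|exact: ind].
  apply/eqP => b0; apply: Nx; apply: HN; right; rewrite /H2 -bigcup_seq/=; exists (T, i).
    exact: mem_index_enum.
  by move/eqP: b0; rewrite /hyperplane/= eq_sym baryE addrC addr_eq0 => /eqP.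
exists N; split => //.
- move=> x Omx _; have : closure Om x by exact: subset_closure.
  by case: tri => _ _ _ -> [T _ Tx]; exists T.
- move=> x T Tx Nx; split; last exact: pos.
  apply: interior_subset; apply: contrapT => nOm; apply: Nx; apply: HN; left.
  have /bdps[p pps px] : bd Om x by split => //; exact: (cell_sub_closure tri Tx).
  by rewrite /H1 -bigcup_seq; exists p.
(* A point interior to both cells lies in the hull of the shared vertices, so each cell has all
   vertices of the other and the cells coincide. *)
- move=> x T T' Tx T'x Nx; have [_ cinj _ _] := tri; apply: cinj.
  by apply/seteqP; split; apply: convex_hullS;
    [apply: (cell_cap_bary0 Tx T'x)|apply: (cell_cap_bary0 T'x Tx)]; exact: pos.
Qed.

End mesh_null_set.

Section elementwise_integrals.
Context {R : realType} {n : nat} (M : mesh R n) (Om N : set 'rV[R]_n.+1).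
Hypothesis tri : triangulation M Om.
Local Notation s := (vtx M).
Local Notation ind := (triangulation_indep tri).
Local Notation mu := (lebesgue_rV n.+1).
Local Notation vol T := (volume (s T)).
Local Notation ctr T := (barycenter (s T)).
Hypothesis mN : measurable N.
Hypothesis N0 : mu N = 0%E.
Hypothesis covN : forall x, Om x -> ~ N x -> exists T : elt M, cell T x.
Hypothesis OmN : forall x (T : elt M), cell T x -> ~ N x -> Om x.
Hypothesis disjN : forall x (T T' : elt M), cell T x -> cell T' x -> ~ N x -> T = T'.

Lemma measurable_cell T : measurable (cell (M := M) T).
Proof. exact: (measurable_simplex (ind (T := T))). Qed.

Lemma glueE (V : nmodType) (f : elt M -> 'rV[R]_n.+1 -> V) x T :
  cell (M := M) T x -> ~ N x -> Defs.glue f x = f T x.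
Proof.
move=> Tx Nx; rewrite /Defs.glue; case: pickP => [T' /asboolP T'x|/(_ T)].
  by rewrite (disjN T'x Tx Nx).
by rewrite asboolT.
Qed.

Lemma eq_integral_mesh (f g : 'rV[R]_n.+1 -> \bar R) :
  (forall x (T : elt M), Om x -> ~ N x -> cell T x -> f x = g x) ->
  (\int[mu]_(x in Om) f x = \int[mu]_(x in Om) g x)%E.
Proof.
move=> fg; apply: (eq_integral_null mN N0) => x Omx Nx.
by have [T Tx] := covN Omx Nx; exact: (fg x T).
Qed.

Lemma integral_restrict_sum (f : 'rV[R]_n.+1 -> \bar R)
    (v : elt M -> 'rV[R]_n.+1 -> \bar R) :
  (forall x (T : elt M), Om x -> ~ N x -> cell T x -> f x = v T x) ->
  (\int[mu]_(x in Om) f x = \int[mu]_x \sum_T (v T \_ (cell (M := M) T)) x)%E.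
Proof.
move=> fv; rewrite integral_mkcond; apply: (eq_integral_null mN N0) => x _ Nx.
rewrite patchE; case: ifPn => [|].
  rewrite inE => Omx; have [T Tx] := covN Omx Nx.
  rewrite (bigD1 T)//= patchE mem_set// (fv x T)// big1 ?adde0// => T' T'T.
  rewrite patchE memNset// => T'x.
  by move: T'T; rewrite (disjN Tx T'x Nx) eqxx.
move=> nOm; rewrite big1// => T _; rewrite patchE memNset// => Tx.
by move/negP: nOm; apply; rewrite inE; exact: OmN Tx Nx.
Qed.

Lemma integral_affine_mesh (f : 'rV[R]_n.+1 -> R) (v : elt M -> 'rV[R]_n.+1 -> R) :
  (forall T, affine_form (v T)) ->
  (forall x (T : elt M), Om x -> ~ N x -> cell T x -> f x = v T x) ->
  \int[mu]_(x in Om) f x = \sum_T vol T * v T (ctr T).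
Proof.
move=> av fv; rewrite /Rintegral.
rewrite (@integral_restrict_sum _ (fun T x => (v T x)%:E)); last first.
  by move=> x T Omx Nx Tx; rewrite (fv x T).
rewrite integral_sum//; last first.
  move=> T; apply/(integrable_mkcond (fun x => (v T x)%:E) (@measurable_cell T)).1.
  exact: (integrable_affine (ind (T := T)) (av T)).
under eq_bigr => T _ do
  rewrite -integral_mkcond (integral_affine (ind (T := T)) (av T)).
by rewrite sumEFin.
Qed.

Lemma ge0_integral_cst_mesh (f : 'rV[R]_n.+1 -> \bar R) (c : elt M -> \bar R) :
  (forall T, 0 <= c T)%E ->
  (forall x (T : elt M), Om x -> ~ N x -> cell T x -> f x = c T) ->
  (\int[mu]_(x in Om) f x = \sum_T c T * (vol T)%:E)%E.
Proof.
move=> c0 fc; rewrite (@integral_restrict_sum _ (fun T _ => c T))//.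
rewrite ge0_integral_sum//.
- apply: eq_bigr => T _; rewrite -integral_mkcond integral_cst; last exact: measurable_cell.
  by congr (_ * _)%E; exact: (volumeE (ind (T := T))).
- move=> T; rewrite -(measurable_restrictT (fun=> c T) (@measurable_cell T)).
  exact: measurable_cst.
- by move=> T x _; rewrite patchE; case: ifPn.
Qed.

(** The values may be +oo but not -oo, so the negative part has a finite integral and subtracting it
    element by element is legitimate. *)
Lemma integral_cst_mesh (f : 'rV[R]_n.+1 -> \bar R) (c : elt M -> \bar R) :
  (forall T, -oo < c T)%E ->
  (forall x (T : elt M), Om x -> ~ N x -> cell T x -> f x = c T) ->
  (\int[mu]_(x in Om) f x = \sum_T c T * (vol T)%:E)%E.
Proof.
move=> c0 fc; rewrite integralE.
rewrite (@ge0_integral_cst_mesh _ (fun T => maxe (c T) 0)%E); first last.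
- by move=> x T Omx Nx Tx; rewrite funeposE (fc x T).
- by move=> T; rewrite le_max lexx orbT.
rewrite (@ge0_integral_cst_mesh _ (fun T => maxe (- c T) 0)%E); first last.
- by move=> x T Omx Nx Tx; rewrite funenegE (fc x T).
- by move=> T; rewrite le_max lexx orbT.
have /choice[r rE] T : exists r : R, (maxe (- c T) 0 * (vol T)%:E = r%:E)%E.
  move: (c0 T); case: (c T) => [x _|_|//].
    by rewrite -EFinN /maxe; case: ifP => _; rewrite -EFinM; eexists.
  by rewrite max_r// mul0e; exists 0.
under [X in (_ - X)%E]eq_bigr do rewrite rE.
rewrite sumEFin -EFinN -sumrN -sumEFin -big_split/=; apply: eq_bigr => T _.
rewrite EFinN -rE; move: (c0 T); case: (c T) => [x _|_|//].
  rewrite -EFinN -!EFin_max -!EFinM -EFinN -EFinD; congr EFin.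
  rewrite -mulNr -mulrDl; congr (_ * _).
  have [x0|x0] := leP 0%R x.
    by rewrite max_r ?oppr_le0// subr0.
  by rewrite max_l ?oppr_ge0 ?ltW// opprK add0r.
by rewrite max_l// max_r// mul0e sube0.
Qed.

Lemma volume_neq0 T : vol T != 0.
Proof. by rewrite gt_eqF//; exact: (volume_gt0 (ind (T := T))). Qed.

(** Testing with the indicator of [T] isolates the term of [T], by the barycenter rule. *)
Lemma L2_projectionP (v : elt M -> 'rV[R]_n.+1 -> R) (p : {ffun elt M -> R}) :
  L1 v -> is_L2_projection Om v p <-> forall T, p T = v T (ctr T).
Proof.
move=> vL.
have E (q : {ffun elt M -> R}) :
    \int[mu]_(x in Om) ((Defs.glue v x - gluec p x) * gluec q x) =
    \sum_T vol T * (q T * (v T (ctr T) - p T)).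
  apply: (@integral_affine_mesh _ (fun T x => q T * (v T x - p T))).
    move=> T; apply: affine_scale; apply: affine_sub; first exact: vL.
    exact: affine_cst.
  by move=> x T Omx Nx Tx; rewrite /gluec !(glueE _ Tx Nx) mulrC.
split => [pP T|pE q].
  have := pP [ffun T' => (T' == T)%:R]; rewrite E (bigD1 T)//= big1.
    rewrite ffunE eqxx mul1r addr0 => /eqP.
    by rewrite mulf_eq0 (negbTE (volume_neq0 T))/= subr_eq0 => /eqP.
  by move=> T' T'T; rewrite ffunE (negbTE T'T) mul0r mulr0.
by rewrite E big1// => T _; rewrite pE subrr !mulr0.
Qed.

Lemma L2_projectionvP (y : elt M -> 'rV[R]_n.+1 -> 'rV[R]_n.+1)
    (p : {ffun elt M -> 'rV[R]_n.+1}) :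
  L1v y -> is_L2_projectionv Om y p <-> forall T, p T = y T (ctr T).
Proof.
move=> yL.
have E (q : {ffun elt M -> 'rV[R]_n.+1}) :
    \int[mu]_(x in Om) dotv (Defs.glue y x - gluec p x) (gluec q x) =
    \sum_T vol T * dotv (q T) (y T (ctr T) - p T).
  apply: (@integral_affine_mesh _ (fun T x => dotv (q T) (y T x - p T))).
    move=> T; apply: affine_sum => j; apply: affine_scale.
    have [a [g gE]] := affine_sub (yL T j) (affine_cst (p T 0 j)).
    by exists a, g => x; rewrite !mxE gE.
  by move=> x T Omx Nx Tx; rewrite /gluec !(glueE _ Tx Nx) dotvC.
split => [pP T|pE q].
  (* Testing with the defect itself on [T] makes its squared length vanish. *)
  pose w := y T (ctr T) - p T.
  have := pP [ffun T' => if T' == T then w else 0]; rewrite E (bigD1 T)//= big1.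
    rewrite ffunE eqxx addr0 => /eqP.
    rewrite mulf_eq0 (negbTE (volume_neq0 T))/= dotv_eq0 subr_eq0.
    by move=> /eqP.
  by move=> T' T'T; rewrite ffunE (negbTE T'T) dotv0l mulr0.
by rewrite E big1// => T _; rewrite pE subrr dotv0r mulr0.
Qed.

Lemma Pi_hE v x T : L1 v -> cell T x -> ~ N x -> Pi_h (M := M) Om v x = v T (ctr T).
Proof.
move=> vL Tx Nx; rewrite /Pi_h /gluec (glueE _ Tx Nx).
case: xgetP => [p _ /(L2_projectionP _ vL)->//|H].
exfalso; apply: (H [ffun T' => v T' (ctr T')]); apply/(L2_projectionP _ vL) => T'.
by rewrite ffunE.
Qed.

Lemma Pi_hvE y x T : L1v y -> cell T x -> ~ N x -> Pi_hv (M := M) Om y x = y T (ctr T).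
Proof.
move=> yL Tx Nx; rewrite /Pi_hv /gluec (glueE _ Tx Nx).
case: xgetP => [p _ /(L2_projectionvP _ yL)->//|H].
exfalso; apply: (H [ffun T' => y T' (ctr T')]); apply/(L2_projectionvP _ yL) => T'.
by rewrite ffunE.
Qed.

End elementwise_integrals.

(** * Equality in the Fenchel-Young inequality *)

Section fenchel.
Context {R : realType}.
Local Open Scope ereal_scope.

Lemma conjugate_ge (T : Type) (pairing : T -> T -> R) (f : T -> \bar R) (x t : T) :
  (pairing x t)%:E - f t <= conjugate pairing f x.
Proof. by apply: ereal_sup_ubound; exists t. Qed.

Lemma conjugate_gtNy (T : Type) (pairing : T -> T -> R) (f : T -> \bar R) (x : T) :
  proper_fun f -> -oo < conjugate pairing f x.
Proof.
move=> [fNy [t ft]]; apply: lt_le_trans (conjugate_ge pairing f x t).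
have : f t \is a fin_num by rewrite fin_numE fNy -ltey.
by move=> /fineK <-; rewrite -EFinB ltNyr.
Qed.

Lemma fenchel_young (T : Type) (pairing : T -> T -> R) (f : T -> \bar R) (x t : T) :
  proper_fun f -> (pairing x t)%:E <= f t + conjugate pairing f x.
Proof.
move=> pf; have := conjugate_ge pairing f x t; have [fNy _] := pf.
have := conjugate_gtNy pairing x pf; move: (fNy t).
case: (f t) => [r| |]// _ cNy; last by rewrite addye ?leey// gt_eqF.
by rewrite leeBlDl.
Qed.

(** The left side of the equality exceeds -oo and the right side is below +oo, so every value is
    real; then a sum of non-negative gaps with positive weights is zero. *)
Lemma fenchel_equality (I : finType) (w : I -> R) (a b c e : I -> \bar R)
    (d p : I -> R) :
  (forall i, 0 < w i)%R ->
  (forall i, -oo < a i) -> (forall i, -oo < b i) ->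
  (forall i, -oo < c i) -> (forall i, -oo < e i) ->
  (forall i, (d i)%:E <= a i + b i) -> (forall i, (p i)%:E <= c i + e i) ->
  \sum_i a i * (w i)%:E + \sum_i c i * (w i)%:E =
    - (\sum_i b i * (w i)%:E) - \sum_i e i * (w i)%:E ->
  (\sum_i w i * (d i + p i) = 0)%R ->
  forall i, (exists r : R, a i = r%:E /\ b i = (d i - r)%:E) /\
            (exists r : R, c i = r%:E /\ e i = (p i - r)%:E).
Proof.
move=> w0 aNy bNy cNy eNy dab pce E dp0.
have term (f : I -> \bar R) i : -oo < f i -> -oo < f i * (w i)%:E.
  case: (f i) => [r| |//] _; first by rewrite -EFinM ltNyr.
  by rewrite gt0_mulye ?lte_fin// ltNye.
have sumNy (f : I -> \bar R) : (forall i, -oo < f i) -> -oo < \sum_i f i * (w i)%:E.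
  move=> fNy; elim/big_ind : _ => // [x y|i _]; last exact: term.
  by case: x => [x| |//]; case: y => [y| |//] _ _; rewrite ?ltNyr ?ltNye.
have fin (f : I -> \bar R) : (forall i, -oo < f i) ->
    \sum_i f i * (w i)%:E \is a fin_num -> exists r : I -> R, f = EFin \o r.
  move=> fNy; rewrite sum_fin_num => /allP H.
  suff /choice[r rE] : forall i, exists r : R, f i = r%:E by exists r; exact/funext.
  move=> i; have : f i * (w i)%:E \is a fin_num.
    by apply: H; apply/mapP; exists i => //; rewrite mem_filter mem_index_enum.
  move: (fNy i); case: (f i) => [r _ _|_|//]; first by exists r.
  by rewrite gt0_mulye ?lte_fin.
(* In any other combination of values one side is infinite and differs from the other. *)
have [[Af Bf] [Cf Ef]] : (\sum_i a i * (w i)%:E \is a fin_num /\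
    \sum_i b i * (w i)%:E \is a fin_num) /\
   (\sum_i c i * (w i)%:E \is a fin_num /\ \sum_i e i * (w i)%:E \is a fin_num).
  move: E (sumNy _ aNy) (sumNy _ bNy) (sumNy _ cNy) (sumNy _ eNy).
  by do 4 case: (\sum_i _) => [?| |]//.
have [ra aE] := fin _ aNy Af; have [rb bE] := fin _ bNy Bf.
have [rc cE] := fin _ cNy Cf; have [re eE] := fin _ eNy Ef.
subst a b c e.
have ab i : (0 <= ra i + rb i - d i)%R by rewrite subr_ge0 -lee_fin EFinD; exact: dab.
have ce i : (0 <= rc i + re i - p i)%R by rewrite subr_ge0 -lee_fin EFinD; exact: pce.
have S0 : (\sum_i w i * ((ra i + rb i - d i) + (rc i + re i - p i)) = 0)%R.
  have sumE (f : I -> R) :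
      \sum_i (EFin \o f) i * (w i)%:E = (\sum_i f i * w i)%R%:E.
    by rewrite -sumEFin; apply: eq_bigr => i _; rewrite EFinM.
  move: E; rewrite !sumE -!EFinN -!EFinD => -[E].
  have -> : (\sum_i w i * (ra i + rb i - d i + (rc i + re i - p i)) =
     \sum_i ra i * w i + \sum_i rc i * w i + \sum_i rb i * w i + \sum_i re i * w i
     - \sum_i w i * (d i + p i))%R.
    by rewrite -!big_split -sumrB/=; apply: eq_bigr => i _; ring.
  by rewrite dp0 E; ring.
move=> i.
have : (w i * ((ra i + rb i - d i) + (rc i + re i - p i)) == 0)%R.
  move/eqP: S0; rewrite psumr_eq0 => [/allP/(_ i (mem_index_enum _))//|j _].
  by apply: mulr_ge0; [exact: ltW|exact: addr_ge0].
rewrite mulf_eq0 gt_eqF//= => /eqP abce.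
have := ab i; have := ce i => ? ?.
split; [exists (ra i)|exists (rc i)]; split=> //=; congr EFin; lra.
Qed.

(** Regrouping is safe because only [x], the value at the competitor, may be infinite. *)
Lemma sub_add_fenchel (x : \bar R) (u d r : R) :
  x - u%:E + (d - r)%:E = x - (u - d)%:E - r%:E.
Proof.
by case: x => [x| |]//; rewrite -!(EFinN, EFinD); congr EFin; ring.
Qed.

End fenchel.

Section elementwise_conjugates.
Context {R : realType} {n : nat} (M : mesh R n) (Om : set 'rV[R]_n.+1).
Hypothesis tri : triangulation M Om.
Local Notation s := (vtx M).
Local Notation ind := (triangulation_indep tri).

(** A cell has positive measure, so it contains a point where [P] holds; constancy on the interior
    carries that integrand to every point of the cell off [N]. *)
Lemma elementwise_constant_ae (psi : 'rV[R]_n.+1 -> R -> \bar R)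
    (P : (R -> \bar R) -> Prop) (N : set 'rV[R]_n.+1) (T : elt M) :
  measurable N -> lebesgue_rV n.+1 N = 0%E ->
  (forall x, cell T x -> ~ N x -> Om x /\ forall i, 0 < bary (s T) i x) ->
  (forall t, elementwise_constant M (fun x => psi x t)) ->
  {ae lebesgue_rV n.+1, forall x, Om x -> P (psi x)} ->
  exists2 q, P q & forall x, cell T x -> ~ N x -> psi x = q.
Proof.
move=> mN N0 NT cpsi [A [mA A0 PA]].
have [x [Tx Nx Ax]] : exists x, [/\ cell T x, ~ N x & ~ A x].
  apply: contrapT => H.
  have sub : cell T `<=` N `|` A.
    move=> x Tx; apply: contrapT => /not_orP[Nx Ax]; apply: H.
    by exists x.
  have nNA : (lebesgue_rV n.+1).-negligible (N `|` A).
    by apply: negligibleU; apply/negligibleP.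
  have := negligibleS sub nNA.
  move=> /negligibleP; rewrite -/(cell T) => H0.
  have := simplex_measure_gt0 (ind (T := T)).
  by rewrite H0 ?ltxx//; exact: (measurable_simplex (ind (T := T))).
have intT y : cell T y -> ~ N y -> (cell T)° y.
  by move=> Ty Ny; apply: (simplex_interior (ind (T := T))); exact: (NT y Ty Ny).2.
exists (psi x).
  apply: contrapT => nP; apply: Ax; apply: PA => /= H; apply: nP; apply: H.
  exact: (NT x Tx Nx).1.
move=> y Ty Ny; apply/funext => t; have [c cE] := cpsi t T.
by rewrite !cE//; exact: intT.
Qed.

End elementwise_conjugates.

(** * Equality in the Fenchel-Young inequalities on each element and the two estimator formulas *)

Local Open Scope ereal_scope.

Theorem proposition4p1 (R : realType) (n : nat) (Om GD GN : set 'rV[R]_n.+1)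
    (M : mesh R n) (kappa : R)
    (phi : 'rV[R]_n.+1 -> \bar R) (psi psih : 'rV[R]_n.+1 -> R -> \bar R)
    (ucr : elt M -> 'rV[R]_n.+1 -> R)
    (zrt : elt M -> 'rV[R]_n.+1 -> 'rV[R]_n.+1) :
  polyhedral_lipschitz_domain Om ->
  boundary_partition Om GD GN ->
  triangulation M Om ->
  shape_regular M kappa ->
  sides_resolve M Om GD GN ->
  pcl_rV phi ->
  measurable_integrand Om psi ->
  {ae lebesgue_rV n.+1, forall x, Om x -> pcl_R (psi x)} ->
  (forall t : R, elementwise_constant M (fun x => psih x t)) ->
  {ae lebesgue_rV n.+1, forall x, Om x -> pcl_R (psih x)} ->
  (exists2 v0 : elt M -> 'rV[R]_n.+1 -> R, CR M GD v0 &
     forall v, CR M GD v -> I_cr M Om phi psih v0 <= I_cr M Om phi psih v) ->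
  {ae lebesgue_rV n.+1, forall x, Om x -> forall t, psi x t = psih x t} ->
  CR M GD ucr ->
  RT M Om GN zrt ->
  I_cr M Om phi psih ucr = D_rt M Om phi psih zrt ->
  \int[lebesgue_rV n.+1]_(x in Om) phi (grad_h ucr x) =
    ereal_sup [set
      \int[lebesgue_rV n.+1]_(x in Om)
        (dotv (grad_h ucr x) (Pi_hv Om y x))%:E -
      \int[lebesgue_rV n.+1]_(x in Om) conj_rV phi (Pi_hv Om y x)
      | y in RT M Om GN] ->
  \int[lebesgue_rV n.+1]_(x in Om) conj_R (psih x) (div_h zrt x) =
    ereal_sup [set
      \int[lebesgue_rV n.+1]_(x in Om) (div_h zrt x * Pi_h Om v x)%R%:E -
      \int[lebesgue_rV n.+1]_(x in Om) psih x (Pi_h Om v x)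
      | v in CR M GD] ->
  forall ut : elt M -> 'rV[R]_n.+1 -> R, S1D M Om GD ut ->
    etaA2 M Om phi ut zrt =
      \int[lebesgue_rV n.+1]_(x in Om)
        (phi (grad_h ut x)
         - (dotv (Pi_hv Om zrt x) (grad_h ut x - grad_h ucr x)%R)%:E
         - phi (grad_h ucr x))
    /\
    etaB2 M Om psih ut zrt =
      \int[lebesgue_rV n.+1]_(x in Om)
        (psih x (Pi_h Om ut x)
         - (div_h zrt x * (Pi_h Om ut x - Pi_h Om ucr x))%R%:E
         - psih x (Pi_h Om ucr x)).
Proof.
move=> [[oOm _ _ _] [poly _]] part tri _ _ pphi _ _ cpsih ppsih _ _ Hu Hz IE _ _ ut _.
have [N [mN N0 covN OmN disjN]] := mesh_null_set tri poly.
have [uL _ _] := Hu; have [zL _ _ _] := Hz.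
have [phip _ _] := pphi.
have OmN' x (T : elt M) Tx Nx := (OmN x T Tx Nx).1.
pose ind := triangulation_indep tri.
pose ctr T := barycenter (vtx M T).
pose vol T := volume (vtx M T).
have /choice[q qP] (T : elt M) : exists q : R -> \bar R,
    pcl_R q /\ forall x, cell T x -> ~ N x -> psih x = q.
  by have [q ? ?] := elementwise_constant_ae tri mN N0 (OmN^~ T) cpsih ppsih; exists q.
have qp T : proper_fun (q T) by have [[]] := qP T.
have qE x T : cell T x -> ~ N x -> psih x = q T by exact: (qP T).2.
(* Gradients and divergences are constant on each element, so 0 serves as an arbitrary evaluation
   point. *)
have gradE x (T : elt M) : cell T x -> ~ N x -> grad_h ucr x = gradient (ucr T) 0.
  move=> Tx Nx; rewrite /grad_h (glueE disjN _ Tx Nx).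
  by have [a [g gE]] := uL T; rewrite !(gradient_affine _ gE).
have divE x (T : elt M) : cell T x -> ~ N x -> div_h zrt x = divergence (zrt T) 0.
  move=> Tx Nx; rewrite /div_h (glueE disjN _ Tx Nx).
  by rewrite !(divergence_bary (ind T) _ (zL T)).
have PiE x (T : elt M) : cell T x -> ~ N x -> Pi_h Om ucr x = ucr T (ctr T).
  exact: (Pi_hE tri mN N0 covN OmN' disjN uL).
have PivE x (T : elt M) : cell T x -> ~ N x -> Pi_hv Om zrt x = zrt T (ctr T).
  exact: (Pi_hvE tri mN N0 covN OmN' disjN zL).
pose a T := phi (gradient (ucr T) 0).
pose b T := conj_rV phi (zrt T (ctr T)).
pose c T := q T (ucr T (ctr T)).
pose e T := conj_R (q T) (divergence (zrt T) 0).
pose d T := dotv (zrt T (ctr T)) (gradient (ucr T) 0).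
pose p T := (divergence (zrt T) 0 * ucr T (ctr T))%R.
have aNy T : -oo < a T by rewrite ltNye; exact: phip.1.
have cNy T : -oo < c T by rewrite ltNye; exact: (qp T).1.
have bNy T : -oo < b T by exact: conjugate_gtNy.
have eNy T : -oo < e T by exact: conjugate_gtNy.
have intE := integral_cst_mesh tri mN N0 covN OmN' disjN.
have sumE : \sum_T a T * (vol T)%:E + \sum_T c T * (vol T)%:E =
    - (\sum_T b T * (vol T)%:E) - \sum_T e T * (vol T)%:E.
  move: IE; rewrite /I_cr /D_rt.
  rewrite (intE _ a aNy) => [|x T _ Nx Tx]; last by rewrite (gradE x T).
  rewrite (intE _ c cNy) => [|x T _ Nx Tx]; last by rewrite (qE x T)// (PiE x T).
  rewrite (intE _ b bNy) => [|x T _ Nx Tx]; last by rewrite (PivE x T).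
  by rewrite (intE _ e eNy) => [|x T _ Nx Tx]; last by rewrite (qE x T)// (divE x T).
have green : (\sum_T vol T * (d T + p T) = 0)%R.
  rewrite -[RHS](discrete_green tri oOm part Hu Hz); apply: eq_bigr => T _.
  by rewrite /d dotvC.
have vol0 T : (0 < vol T)%R by exact: (volume_gt0 (ind T)).
have FY := fenchel_equality vol0 aNy bNy cNy eNy
  (fun T => fenchel_young dotv (zrt T (ctr T)) (gradient (ucr T) 0) phip)
  (fun T => fenchel_young *%R (divergence (zrt T) 0) (ucr T (ctr T)) (qp T))
  sumE green.
(* The integrands agree pointwise off [N]: the conjugate value is replaced by the pairing minus the
   real primal value at [ucr]. *)
split; apply: (eq_integral_mesh mN N0 covN) => x T Omx Nx Tx.
  have [[r [aE bE]] _] := FY T.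
  rewrite (gradE x T)// (PivE x T)// -/(a T) -/(b T) aE bE.
  by rewrite dotvBr; exact: sub_add_fenchel.
have [_ [r [cE eE]]] := FY T.
rewrite (qE x T)// (PiE x T)// (divE x T)// -/(c T) -/(e T) cE eE.
by rewrite mulrBr; exact: sub_add_fenchel.
Qed.
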